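(* Let $u_1,\dots,u_m\in\mathbb{R}^n\setminus\{0\}$, let $p\in\mathbb{R}[x_1,\dots,x_m]$, and let $\mathcal{S}=p(\mathcal{X}_{u_1},\dots,\mathcal{X}_{u_m})$ be a nonzero star transform that is realizable on $\mathbb{R}^n$. Let $\mathcal{L}=p^*(\mathcal{D}_{u_1},\dots,\mathcal{D}_{u_m})$ be its dual differential operator. Then $\mathcal{S}$, considered as an operator from $C_c^\infty(\mathbb{R}^n)$ to $C^\infty(\mathbb{R}^n)$, is injective if and only if $\mathcal{L}\neq 0$.
   Context: For $u\in\mathbb{R}^n\setminus\{0\}$, the divergent beam transform is $(\mathcal{X}_u f)(x)=\int_{-\infty}^{0} f(x+tu)\,dt$, and $\mathcal{D}_u$ is the directional derivative along $u$, $\mathcal{D}_u f=u\cdot\nabla f$. The transforms $\mathcal{X}_u$ commute. A (formal) star transform is $\mathcal{S}=p(\mathcal{X}_{u_1},\dots,\mathcal{X}_{u_m})$, a polynomial expression in the $\mathcal{X}_{u_i}$ (products meaning composition, the constant term acting as a multiple of the identity); formally it is an element of the free commutative $\mathbb{R}$-algebra on symbols $\mathcal{X}_u$, $u\in S^{n-1}$, where $\mathcal{X}_{au}=\frac1a\mathcal{X}_u$ for $a>0$. The vectors $u_i$ are the branch vectors. For polynomials of degree greater than $1$ the iterated integrals defining $\mathcal{S}f$ may diverge; $\mathcal{S}$ is called realizable on $\mathbb{R}^n$ if no such divergence occurs, i.e. for all $f\in C_c^\infty(\mathbb{R}^n)$ the iterated integrals defining $\mathcal{S}f$ converge, so that $\mathcal{S}$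 is a linear map $C_c^\infty(\mathbb{R}^n)\to C^\infty(\mathbb{R}^n)$. The reciprocal polynomial of $p$ is $p^*(x_1,\dots,x_m)=x_1^{d_1}\cdots x_m^{d_m}\,p(x_1^{-1},\dots,x_m^{-1})$, where $d_j$ is the degree of $p$ in the variable $x_j$. The dual differential operator of $\mathcal{S}$ is the constant-coefficient differential operator $\mathcal{L}=p^*(\mathcal{D}_{u_1},\dots,\mathcal{D}_{u_m})$; equivalently its total symbol is $p^*(U\xi)$, where $U$ is the $m\times n$ matrix with rows $u_1,\dots,u_m$ and $\xi=(\xi_1,\dots,\xi_n)^T$. *)

(* Defs.v *)
From HB Require Import structures.
From mathcomp Require Import all_boot all_order all_algebra finmap.
From mathcomp Require Import all_classical all_reals all_analysis.
From mathcomp Require mpoly monalg.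
(* The notations of these two files clash with those of the analysis library. *)
Export (canonicals, coercions) mpoly monalg.

Set Implicit Arguments.
Unset Strict Implicit.
Unset Printing Implicit Defensive.

Import Order.TTheory GRing.Theory Num.Theory.
Import numFieldNormedType.Exports.

Local Open Scope classical_set_scope.
Local Open Scope ring_scope.

(* The library norm on ['rV[R]_n] is the sup norm, hence an explicit Euclidean
   norm for the unit sphere. *)
Definition enorm (R : realType) (n : nat) (v : 'rV[R]_n) : R :=
  Num.sqrt (\sum_(i < n) v 0 i ^+ 2).

Definition sphere (R : realType) (n : nat) : choiceType :=
  {v : 'rV[R]_n | enorm v == 1}.

Lemma enorm_normalize (R : realType) (n : nat) (v : 'rV[R]_n) :
  v != 0 -> enorm ((enorm v)^-1 *: v) == 1.
Proof.
move=> v0.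
have s0 : 0 <= \sum_(i < n) v 0 i ^+ 2 by apply: sumr_ge0 => i _; exact: sqr_ge0.
have e0 : enorm v != 0.
  apply: contraNneq v0 => /eqP; rewrite sqrtr_eq0 => sle0.
  have /eqP : \sum_(i < n) v 0 i ^+ 2 = 0 by apply/le_anti; rewrite sle0 s0.
  rewrite psumr_eq0 => [/allP h|i _]; last exact: sqr_ge0.
  apply/eqP/rowP => i; rewrite mxE.
  by have := h i (mem_index_enum i); rewrite /= sqrf_eq0 => /eqP.
rewrite {1}/enorm (eq_bigr (fun i => (enorm v)^-1 ^+ 2 * v 0 i ^+ 2)); last first.
  by move=> i _; rewrite mxE exprMn.
by rewrite -mulr_sumr sqrtrM ?sqr_ge0// sqrtr_sqr ger0_norm ?invr_ge0 ?sqrtr_ge0// mulVf.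
Qed.

Definition direction (R : realType) (n : nat) (v : 'rV[R]_n) (v0 : v != 0) :
  sphere R n := exist _ ((enorm v)^-1 *: v) (enorm_normalize v0).

(* Formal star transforms: the free commutative R-algebra on symbols X_w indexed
   by the unit sphere. *)
Definition formal_star (R : realType) (n : nat) : comNzRingType :=
  monalg.malg (monalg.cmonom (sphere R n)) R.

(* X_v for v <> 0, read as X_{a w} = a^-1 X_w with a = |v| and w = v / |v|. *)
Definition beam_symbol (R : realType) (n : nat) (v : 'rV[R]_n) (v0 : v != 0) :
  formal_star R n :=
  monalg.mkmalgU (monalg.ucm (direction v0)) (enorm v)^-1.

Definition star_transform (R : realType) (n m : nat) (u : 'I_m -> 'rV[R]_n)
    (u0 : forall i, u i != 0) (p : mpoly.mpoly m R) : formal_star R n :=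
  mpoly.mmap (fun c : R => monalg.mkmalgU monalg.mone c : formal_star R n)
    (fun i => beam_symbol (u0 i)) p.

Definition beam (R : realType) (n : nat) (v : 'rV[R]_n) (f : 'rV[R]_n -> R) :
  'rV[R]_n -> R :=
  fun x => \int[lebesgue_measure]_(t in `]-oo, 0%R]) f (x + t *: v).

Definition beam_converges (R : realType) (n : nat) (v : 'rV[R]_n)
    (f : 'rV[R]_n -> R) : Prop :=
  forall x, lebesgue_measure.-integrable `]-oo, 0%R]
    (fun t : R => (f (x + t *: v))%:E).

Fixpoint iter_beam (R : realType) (n : nat) (w : seq 'rV[R]_n)
    (f : 'rV[R]_n -> R) : 'rV[R]_n -> R :=
  if w is v :: w' then beam v (iter_beam w' f) else f.

Fixpoint iter_beam_converges (R : realType) (n : nat) (w : seq 'rV[R]_n)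
    (f : 'rV[R]_n -> R) : Prop :=
  if w is v :: w' then
    iter_beam_converges w' f /\ beam_converges v (iter_beam w' f)
  else True.

(* The directions of a monomial, with multiplicity. Their order is that of the
   enumeration of the finite support; it is immaterial since beams commute. *)
Definition monomial_word (R : realType) (n : nat)
    (k : monalg.cmonom (sphere R n)) : seq 'rV[R]_n :=
  flatten [seq nseq (k w) (val w) | w <- finsupp k].

Definition star_op (R : realType) (n : nat) (S : formal_star R n)
    (f : 'rV[R]_n -> R) : 'rV[R]_n -> R :=
  fun x => \sum_(k <- monalg.msupp S)
    monalg.mcoeff k S * iter_beam (monomial_word k) f x.

Fixpoint Ck (R : realType) (n : nat) (k : nat) (f : 'rV[R]_n -> R) : Prop :=
  continuous f /\
  if k is k'.+1 then
    forall i : 'I_n, (forall x, derivable f x (delta_mx 0 i)) /\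
                     Ck k' (fun x => 'D_(delta_mx 0 i) f x)
  else True.

Definition Cinfty (R : realType) (n : nat) : set ('rV[R]_n -> R) :=
  [set f | forall k, Ck k f].

Definition Ccinfty (R : realType) (n : nat) : set ('rV[R]_n -> R) :=
  [set f | Cinfty f /\ compact (closure [set x | f x != 0])].

Definition realizable (R : realType) (n : nat) (S : formal_star R n) : Prop :=
  forall f, Ccinfty f -> forall k, k \in monalg.msupp S ->
    iter_beam_converges (monomial_word k) f.

Definition degree_in (R : realType) (m : nat) (j : 'I_m)
    (p : mpoly.mpoly m R) : nat :=
  \max_(k <- mpoly.msupp p) k j.

(* x^d p(x^-1), expanded: the monomial x^k of p becomes x^(d - k). *)
Definition reciprocal (R : realType) (m : nat) (p : mpoly.mpoly m R) :
  mpoly.mpoly m R :=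
  \sum_(k <- mpoly.msupp p) mpoly.mcoeff k p *:
    mpoly.mpolyX R (mpoly.Multinom [tuple (degree_in j p - k j)%N | j < m]).

Definition iter_deriv (R : realType) (n m : nat) (u : 'I_m -> 'rV[R]_n)
    (k : 'I_m -> nat) (f : 'rV[R]_n -> R) : 'rV[R]_n -> R :=
  foldr (fun i g => iter (k i) (fun h x => 'D_(u i) h x) g) f (enum 'I_m).

(* q(D_{u_1}, ..., D_{u_m}), meaningful on smooth functions. *)
Definition poly_deriv (R : realType) (n m : nat) (q : mpoly.mpoly m R)
    (u : 'I_m -> 'rV[R]_n) (f : 'rV[R]_n -> R) : 'rV[R]_n -> R :=
  fun x => \sum_(k <- mpoly.msupp q) mpoly.mcoeff k q * iter_deriv u k f x.

Definition dual_op (R : realType) (n m : nat) (u : 'I_m -> 'rV[R]_n)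
    (p : mpoly.mpoly m R) : ('rV[R]_n -> R) -> 'rV[R]_n -> R :=
  poly_deriv (reciprocal p) u.

(* Main.v *)
(** Since [X_v D_v g = g] for compactly supported [g], applying [S] to [D^d g], where
    [D^d] is the product of the [D_(u_j)^(d_j)], gives [L g]; if [L = 0], a nonzero bump
    function [g] yields the nonzero element [D^d g] of the kernel of [S].

    Conversely let [S f = 0]. As [S] commutes with translations, it annihilates every
    iterated difference [Delta_h^d f] along the branch directions. Now [X_v Delta_(h v)]
    is integration over [[0, h]] along [v], whose value is [h] times a nearby value of the
    function; dividing [S (Delta_h^d f) = 0] by [h^|d|] and letting [h] tend to 0 gives
    [L f = 0]. Finally a nonzero constant-coefficient operator [P(D)] is injective on
    compactly supported functions, by Hormander's argument: [P(D) f = 0] implies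
    [P^(j)(D) f = 0] for every partial derivative [P^(j)] of the symbol, and one
    concludes by induction on the degree. *)

Require Import Defs.
From mathcomp Require Import all_boot all_order all_algebra.
From mathcomp Require Import all_classical all_reals all_analysis.
From mathcomp Require mpoly monalg finmap.
Import (coercions) finmap.
From mathcomp Require Import ring lra.

Set Implicit Arguments.
Unset Strict Implicit.
Unset Printing Implicit Defensive.

Import Order.TTheory GRing.Theory Num.Theory.
Import numFieldNormedType.Exports.

Local Open Scope classical_set_scope.
Local Open Scope ring_scope.

(** * Directional derivatives *)

(** Differences replace derivatives in the converse because X_v f has unbounded support in general
    and realizability gives convergence of the iterated integrals but no bounds, so differentiating
    under them is out of reach; differences require only linearity and translation invariance. Every
    letter of a monomial is differenced before its beams are applied: each intermediate function is
    then continuous with bounded support, and a mean value theorem with a controlled evaluation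
    point survives the iteration.

    Monomials are handled as words of vectors up to permutation: x^k and x^(d-k) are complementary
    parts of the word of x^d. The formal algebra knows only unit directions; the resulting powers of
    |u_i| combine into a nonzero factor depending on d alone. In Hormander's argument the L^2 inner
    product is replaced by averages over ever finer grids of a box. *)

Lemma is_derive_line (R : realType) (V : normedModType R) (f : V -> R)
    (x v : V) (t : R) :
  derivable f (x + t *: v) v ->
  is_derive t (1 : R) (fun s : R => f (x + s *: v)) ('D_v f (x + t *: v)).
Proof.
move=> df.
have e : (fun h : R => h^-1 *:
     (((fun s : R => f (x + s *: v)) \o shift t) (h *: (1 : R)) - f (x + t *: v)))
   = (fun h : R => h^-1 *: ((f \o shift (x + t *: v)) (h *: v) - f (x + t *: v))).
  apply/funext => h /=; congr (_ *: (f _ - _)).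
  by rewrite scalerDl /GRing.scale /= mulr1 addrCA.
by split; rewrite /derivable /derive /= e.
Qed.

Lemma line_continuous (R : realType) (V : normedModType R) (x v : V) :
  continuous (fun t : R => x + t *: v).
Proof.
move=> t; apply: cvgD; first exact: cvg_cst.
by apply: cvgZr_tmp; exact: cvg_id.
Qed.

Lemma dir_MVT (R : realType) (V : normedModType R) (f : V -> R) (x v : V) (h : R) :
  (forall y, derivable f y v) ->
  exists2 t : R, `|t| <= `|h| & f (x + h *: v) - f x = h * 'D_v f (x + t *: v).
Proof.
move=> df.
pose g (s : R) := f (x + s *: v).
have dg s : is_derive s (1 : R) g ('D_v f (x + s *: v)) by exact: is_derive_line.
have cg : continuous g.
  by move=> s; apply: differentiable_continuous; apply/derivable1_diffP; have [] := dg s.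
have [h0|h0] := leP 0 h.
- have [|t] := @MVT_segment R g (fun s => 'D_v f (x + s *: v)) 0 h h0 (fun s _ => dg s).
    exact: continuous_subspaceT.
  rewrite in_itv /= subr0 => /andP[t0 th] e; exists t.
    by rewrite !ger0_norm.
  by rewrite mulrC -e /g scale0r addr0.
- have [|t] := @MVT_segment R g (fun s => 'D_v f (x + s *: v)) h 0 (ltW h0) (fun s _ => dg s).
    exact: continuous_subspaceT.
  rewrite in_itv /= sub0r => /andP[t0 th] e; exists t.
    by rewrite !ler0_norm ?lerN2// ltW.
  by rewrite mulrC -[RHS]opprK -mulrN -e /g scale0r addr0 opprB.
Qed.

(** The increment along h (w + v) splits into a leg along h w and a leg along h v starting at x + h
    w. The mean value theorem turns the second into h times ['D_v f] at a point within |h| (|w| +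
    |v|) of x, where continuity at x applies. *)
Lemma is_derive_addv (R : realType) (V : normedModType R) (f : V -> R) (x w v : V)
    (l : R) :
  is_derive x w f l -> (forall y, derivable f y v) ->
  {for x, continuous (fun y => 'D_v f y)} ->
  is_derive x (w + v) f (l + 'D_v f x).
Proof.
move=> [dw dwl] dv cv.
suff H : (fun h : R => h^-1 *: ((f \o shift x) (h *: (w + v)) - f x)) @ 0^' -->
    l + 'D_v f x.
  split; first by apply/cvg_ex; eexists; exact: H.
  exact/cvg_lim.
have e (h : R) : h^-1 *: ((f \o shift x) (h *: (w + v)) - f x) =
   h^-1 *: ((f \o shift x) (h *: w) - f x) +
   h^-1 *: (f ((x + h *: w) + h *: v) - f (x + h *: w)).
  rewrite -scalerDr /= [h *: w + x]addrC.
  have -> : h *: (w + v) + x = x + h *: w + h *: v.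
    by rewrite scalerDr addrC addrA.
  by congr (_ *: _); rewrite [RHS]addrC addrA subrK.
under eq_fun do rewrite e.
apply: cvgD; first by rewrite -dwl.
apply/cvgrPdist_lt => e0 e00.
have /cvgrPdist_lt/(_ _ e00) /nbhs_ballP[d d0 H] := cv.
near=> h.
have hn0 : h != 0 by near: h; exact: nbhs_dnbhs_neq.
have [t th ->] := @dir_MVT R V f (x + h *: w) v h dv.
rewrite /GRing.scale /= mulKf //; apply: H.
rewrite -ball_normE /ball_ /= opprD addrA opprD addrA subrr add0r -opprD normrN.
apply: (le_lt_trans (ler_normD _ _)); rewrite !normrZ.
apply: (@le_lt_trans _ _ (`|h| * (`|w| + `|v|))).
  by rewrite mulrDr lerD2l ler_wpM2r.
have N0 : 0 < `|w| + `|v| + 1 by rewrite ltr_wpDl // addr_ge0.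
apply: (@le_lt_trans _ _ (`|h| * (`|w| + `|v| + 1))).
  by rewrite ler_wpM2l // lerDl.
rewrite -ltr_pdivlMr //.
near: h; apply: nbhs_dnbhs.
have : nbhs (0 : R) (ball (0 : R) (d / (`|w| + `|v| + 1))).
  by apply: nbhsx_ballx; rewrite divr_gt0.
by apply: filterS => h; rewrite -ball_normE /ball_ /= sub0r normrN.
Unshelve. all: by end_near. Qed.

Lemma is_derive_translate (R : realType) (V : normedModType R) (f : V -> R)
    (x v y : V) (l : R) :
  is_derive (x + y) v f l -> is_derive x v (fun z => f (z + y)) l.
Proof.
have e : (fun h : R => h^-1 *: (((fun z => f (z + y)) \o shift x) (h *: v) - f (x + y)))
   = (fun h : R => h^-1 *: ((f \o shift (x + y)) (h *: v) - f (x + y))).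
  by apply/funext => h /=; rewrite addrA.
by move=> [d dl]; split; rewrite /derivable /derive /= e.
Qed.

Lemma is_derive_coord (R : realType) (n : nat) (phi : R -> R) (x v : 'rV[R]_n)
    (i : 'I_n) (l : R) :
  is_derive (x 0 i) (1 : R) phi l ->
  is_derive x v (fun z : 'rV[R]_n => phi (z 0 i)) (v 0 i * l).
Proof.
move=> [d dl].
have dphi : differentiable phi (x 0 i) by apply/derivable1_diffP.
have e : (fun h : R => h^-1 *:
     (((fun z : 'rV[R]_n => phi (z 0 i)) \o shift x) (h *: v) - phi (x 0 i)))
   = (fun h : R => h^-1 *: ((phi \o shift (x 0 i)) (h *: v 0 i) - phi (x 0 i))).
  by apply/funext => h /=; rewrite !mxE.
split; rewrite /derivable /derive /= e.
  exact: (diff_derivable dphi).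
rewrite -/(derive phi (x 0 i) (v 0 i)) deriveE //.
by rewrite -dl deriveE // -[in LHS](mulr1 (v 0 i)) -[v 0 i * 1]/(v 0 i *: (1 : R)) linearZ.
Qed.

Lemma continuous_translate (R : realType) (V : normedModType R) (f : V -> R) (y : V) :
  continuous f -> continuous (fun x => f (x + y)).
Proof.
move=> cf x; apply: (@continuous_comp _ _ _ (fun z => z + y) f x).
  by apply: (@continuousD _ _ _ id (cst y) x); [exact: cvg_id|exact: cst_continuous].
exact: cf.
Qed.

Arguments continuous_translate [R V f] y cf : rename.

(** * Smooth functions *)

Section Smooth.
Variables (R : realType) (n : nat).
Implicit Types (f g : 'rV[R]_n -> R) (x y v w : 'rV[R]_n).

Lemma Ck_continuous k f : Ck k f -> continuous f.
Proof. by case: k => [|k] []. Qed.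

Lemma Ck_derivable k f : Ck k.+1 f ->
  forall i x, derivable f x (delta_mx 0 i).
Proof. by move=> [_ H] i x; have [] := H i. Qed.

Arguments Ck_derivable [k f] Hf i x : rename.

Lemma Ck_partial k f : Ck k.+1 f ->
  forall i, Ck k (fun x => 'D_(delta_mx 0 i) f x).
Proof. by move=> [_ H] i; have [] := H i. Qed.

Lemma CkW k f : Ck k.+1 f -> Ck k f.
Proof.
elim: k f => [|k IH] f [cf H]; split => // i.
by have [d c] := H i; split => //; exact: IH.
Qed.

Lemma Ck_add k f g : Ck k f -> Ck k g -> Ck k (fun x => f x + g x).
Proof.
elim: k f g => [|k IH] f g [cf Hf] [cg Hg].
  by split => // x; apply: (@continuousD _ _ _ f g x); [exact: cf|exact: cg].
split => [x|i]; first by apply: (@continuousD _ _ _ f g x); [exact: cf|exact: cg].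
have [df Df] := Hf i; have [dg Dg] := Hg i.
split => [x|]; first exact: derivableD.
have -> : (fun x => 'D_(delta_mx 0 i) (fun x0 => f x0 + g x0) x) =
   fun x => 'D_(delta_mx 0 i) f x + 'D_(delta_mx 0 i) g x.
  by apply/funext => x; rewrite -deriveD.
exact: IH.
Qed.

Lemma Ck_cst k c : Ck k (fun _ : 'rV[R]_n => c).
Proof.
elim: k c => [|k IH] c; (split => //; try by move=> x; exact: cst_continuous).
move=> i; split => [x|]; first exact: derivable_cst.
have -> : (fun x => 'D_(delta_mx 0 i) (fun _ : 'rV[R]_n => c) x) = fun _ => 0.
  by apply/funext => x; rewrite (@derive_cst _ _ _ c).
exact: IH.
Qed.

Lemma Ck_mul k f g : Ck k f -> Ck k g -> Ck k (fun x => f x * g x).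
Proof.
elim: k f g => [|k IH] f g Hf Hg.
  split => // x; apply: (@continuousM _ _ f g x);
    [exact: (Ck_continuous Hf)|exact: (Ck_continuous Hg)].
split => [x|i].
  by apply: (@continuousM _ _ f g x);
    [exact: (Ck_continuous Hf)|exact: (Ck_continuous Hg)].
have df := Ck_derivable Hf i; have dg := Ck_derivable Hg i.
split => [x|]; first exact: derivableM.
have -> : (fun x => 'D_(delta_mx 0 i) (fun x0 => f x0 * g x0) x) =
   fun x => f x * 'D_(delta_mx 0 i) g x + g x * 'D_(delta_mx 0 i) f x.
  by apply/funext => x; rewrite (@deriveM _ _ f g).
by apply: Ck_add; apply: IH; [exact: CkW|exact: Ck_partial|exact: CkW|exact: Ck_partial].
Qed.

Lemma Ck_translate k f y : Ck k f -> Ck k (fun x => f (x + y)).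
Proof.
elim: k f => [|k IH] f Hf.
  by split => //; apply: continuous_translate; exact: (Ck_continuous Hf).
split => [|i]; first by apply: continuous_translate; exact: (Ck_continuous Hf).
have d x : is_derive x (delta_mx 0 i) (fun z => f (z + y)) ('D_(delta_mx 0 i) f (x + y)).
  by apply: is_derive_translate; apply/derivableP; exact: (Ck_derivable Hf).
split => [x|]; first by have [] := d x.
have -> : (fun x => 'D_(delta_mx 0 i) (fun z => f (z + y)) x) =
   fun x => (fun z => 'D_(delta_mx 0 i) f z) (x + y).
  by apply/funext => x; have [_ ->] := d x.
exact: (IH _ (Ck_partial Hf i)).
Qed.

(** The vector v is built up one coordinate at a time with [is_derive_addv], whose continuity
    condition is that of the partial derivatives. *)
Lemma Ck_is_derive k f x v : Ck k.+1 f ->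
  is_derive x v f (\sum_i v 0 i * 'D_(delta_mx 0 i) f x).
Proof.
move=> Hf.
rewrite {1}(row_sum_delta v).
elim: (index_enum _) => [|i s IH].
  by rewrite !big_nil; exact: is_derive0.
rewrite !big_cons addrC [X in is_derive _ _ _ X]addrC.
have d y : is_derive y (v 0 i *: delta_mx 0 i) f (v 0 i * 'D_(delta_mx 0 i) f y).
  have [->|v0] := eqVneq (v 0 i) 0; first by rewrite scale0r mul0r; exact: is_derive0.
  have df := Ck_derivable Hf i y.
  have e : (fun h : R => h^-1 *: ((f \o shift y) (h *: (v 0 i *: delta_mx 0 i)) - f y)) =
    (fun h => v 0 i * ((h * v 0 i)^-1 *: ((f \o shift y) ((h * v 0 i) *: delta_mx 0 i) - f y))).
    apply/funext => h; rewrite scalerA /GRing.scale /= mulrA; congr (_ * _).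
    by rewrite invfM mulrCA mulfV // mulr1.
  have c : (fun h => v 0 i * ((h * v 0 i)^-1 *: ((f \o shift y) ((h * v 0 i) *: delta_mx 0 i) - f y))) @ 0^'
     --> v 0 i * 'D_(delta_mx 0 i) f y.
    apply: cvgM; first exact: cvg_cst.
    apply: (@cvg_comp _ _ _ (fun h : R => h * v 0 i)
      (fun h => h^-1 *: ((f \o shift y) (h *: delta_mx 0 i) - f y)) _ 0^'); last exact: df.
    move=> A [d d0 H].
    exists (d / `|v 0 i|); first by rewrite /= divr_gt0 // normr_gt0.
    move=> h; rewrite /ball_ /= sub0r normrN => hd h0; apply: H; last by rewrite mulf_neq0.
    by rewrite /ball_ /= sub0r normrN normrM -ltr_pdivlMr // normr_gt0.
  split; first by rewrite /derivable e; apply/cvg_ex; eexists; exact: c.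
  by rewrite /derive e; apply: cvg_lim => //; exact: c.
rewrite -[v 0 i * _](@derive_val _ _ _ _ _ _ _ (d x)).
refine (is_derive_addv IH _ _) => [y|]; first by have [] := d y.
have -> : (fun y => 'D_(v 0 i *: delta_mx 0 i) f y) = fun y => v 0 i * 'D_(delta_mx 0 i) f y.
  by apply/funext => y; rewrite derive_val.
by apply: (@continuousM _ _ (cst (v 0 i)) _ x);
  [exact: cst_continuous|exact: (Ck_continuous (Ck_partial Hf i))].
Qed.

Lemma Ck_sum k (I : Type) (r : seq I) (F : I -> 'rV[R]_n -> R) :
  (forall i, Ck k (F i)) -> Ck k (fun x => \sum_(i <- r) F i x).
Proof.
move=> H; elim: r => [|i r IH].
  by under eq_fun do rewrite big_nil; exact: Ck_cst.
by under eq_fun do rewrite big_cons; exact: Ck_add.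
Qed.

Lemma Ck_derive k f v : Ck k.+1 f -> Ck k (fun x => 'D_v f x).
Proof.
move=> Hf.
have -> : (fun x => 'D_v f x) = fun x => \sum_i v 0 i * 'D_(delta_mx 0 i) f x.
  by apply/funext => x; have [] := Ck_is_derive x v Hf.
by apply: Ck_sum => i; apply: Ck_mul; [exact: Ck_cst|exact: Ck_partial].
Qed.

Lemma Cinfty_continuous f : Cinfty f -> continuous f.
Proof. by move=> /(_ 0%N)/Ck_continuous. Qed.

Lemma Cinfty_derivable f : Cinfty f -> forall x v, derivable f x v.
Proof. by move=> /(_ 1%N) H x v; have [] := Ck_is_derive x v H. Qed.

Arguments Cinfty_derivable [f] Hf x v : rename.

Lemma Cinfty_deriveE f : Cinfty f -> forall x v,
  'D_v f x = \sum_i v 0 i * 'D_(delta_mx 0 i) f x.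
Proof. by move=> /(_ 1%N) H x v; have [] := Ck_is_derive x v H. Qed.

Lemma Cinfty_derive f v : Cinfty f -> Cinfty (fun x => 'D_v f x).
Proof. by move=> H k; exact: Ck_derive. Qed.

Lemma Cinfty_add f g : Cinfty f -> Cinfty g -> Cinfty (fun x => f x + g x).
Proof. by move=> Hf Hg k; exact: Ck_add. Qed.

Lemma Cinfty_mul f g : Cinfty f -> Cinfty g -> Cinfty (fun x => f x * g x).
Proof. by move=> Hf Hg k; exact: Ck_mul. Qed.

Lemma Cinfty_cst c : Cinfty (fun _ : 'rV[R]_n => c).
Proof. by move=> k; exact: Ck_cst. Qed.

Lemma Cinfty_sub f g : Cinfty f -> Cinfty g -> Cinfty (fun x => f x - g x).
Proof.
move=> Hf Hg; have -> : (fun x => f x - g x) = (fun x => f x + -1 * g x).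
  by apply/funext => x; rewrite mulN1r.
by apply: Cinfty_add => //; apply: Cinfty_mul => //; exact: Cinfty_cst.
Qed.

Lemma Cinfty_sum (I : Type) (r : seq I) (F : I -> 'rV[R]_n -> R) :
  (forall i, Cinfty (F i)) -> Cinfty (fun x => \sum_(i <- r) F i x).
Proof. by move=> H k; apply: Ck_sum => i; exact: H. Qed.

Lemma Cinfty_translate f y : Cinfty f -> Cinfty (fun x => f (x + y)).
Proof. by move=> Hf k; exact: Ck_translate. Qed.

Lemma Cinfty_coord (i : 'I_n) : Cinfty (fun x : 'rV[R]_n => x 0 i).
Proof.
have d x v : is_derive x v (fun x : 'rV[R]_n => x 0 i) (v 0 i).
  by rewrite -[X in is_derive _ _ _ X]mulr1; exact: (@is_derive_coord _ _ id).
case=> [|k]; split => //; try exact: coord_continuous.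
move=> j; split => [x|]; first by have [] := d x (delta_mx 0 j).
under eq_fun do rewrite (@derive_val _ _ _ _ _ _ _ (d _ _)).
exact: Ck_cst.
Qed.

End Smooth.

Arguments Ck_derivable [R n k f] Hf i x : rename.
Arguments Cinfty_derivable [R n f] Hf x v : rename.

(** * Iterated derivatives and differences *)

(** Commutation is demanded on every argument. Differences satisfy this, whereas derivatives commute
    only on smooth functions; they inherit the property through a limit. *)
Lemma foldr_perm (T : eqType) (A : Type) (op : T -> A -> A) (a : A) (s t : seq T) :
  (forall u v b, op u (op v b) = op v (op u b)) ->
  perm_eq s t -> foldr op a s = foldr op a t.
Proof.
move=> opC.
have opcat u (s1 s2 : seq T) : foldr op a (s1 ++ u :: s2) = op u (foldr op a (s1 ++ s2)).
  by elim: s1 => //= v s1 ->; rewrite opC.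
elim: s t => [|u s IH] t; first by rewrite perm_sym => /perm_nilP ->.
move=> st; have ut : u \in t by rewrite -(perm_mem st) mem_head.
case/splitPr: ut st => t1 t2 st.
rewrite opcat /= (IH (t1 ++ t2)) //.
by rewrite -(perm_cons u) (perm_trans st) // perm_catC /= perm_cons perm_catC.
Qed.

Definition dird (R : realType) (n : nat) (s : seq 'rV[R]_n) (f : 'rV[R]_n -> R) :=
  foldr (fun v g x => 'D_v g x) f s.

Definition fdiff (R : realType) (n : nat) (h : R) (s : seq 'rV[R]_n)
    (f : 'rV[R]_n -> R) :=
  foldr (fun v g x => g (x + h *: v) - g x) f s.

Section Words.
Variables (R : realType) (n : nat).
Implicit Types (f g : 'rV[R]_n -> R) (x y v w : 'rV[R]_n) (s t : seq 'rV[R]_n).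

Lemma Cinfty_dird s f : Cinfty f -> Cinfty (dird s f).
Proof. by move=> Hf; elim: s => //= v s IH; exact: Cinfty_derive. Qed.

Lemma dird_cat s t f : dird (s ++ t) f = dird s (dird t f).
Proof. exact: foldr_cat. Qed.

Lemma derive_translate f x y v : Cinfty f ->
  'D_v (fun z => f (z + y)) x = 'D_v f (x + y).
Proof.
move=> Hf.
have [] // := @is_derive_translate R _ f x v y ('D_v f (x + y)).
by apply/derivableP; exact: Cinfty_derivable.
Qed.

Lemma dird_translate s f y : Cinfty f ->
  dird s (fun x => f (x + y)) = fun x => dird s f (x + y).
Proof.
move=> Hf; elim: s => //= v s ->.
by apply/funext => x; rewrite (derive_translate _ _ _ (Cinfty_dird _ Hf)).
Qed.

Lemma derive_addE f g v x : Cinfty f -> Cinfty g ->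
  'D_v (fun z => f z + g z) x = 'D_v f x + 'D_v g x.
Proof.
move=> Hf Hg.
by rewrite (@deriveD _ _ _ f g) //; exact: Cinfty_derivable.
Qed.

Lemma derive_mulE f g v x : Cinfty f -> Cinfty g ->
  'D_v (fun z => f z * g z) x = f x * 'D_v g x + 'D_v f x * g x.
Proof.
move=> Hf Hg.
rewrite (@deriveM _ _ f g) /GRing.scale /=; first by rewrite [g x * _]mulrC.
  exact: Cinfty_derivable.
exact: Cinfty_derivable.
Qed.

Lemma derive_cstE (c : R) v x : 'D_v (fun _ : 'rV[R]_n => c) x = 0.
Proof. exact: (@derive_cst _ _ _ c). Qed.

Lemma derive_scaleE c f v x : Cinfty f ->
  'D_v (fun z => c * f z) x = c * 'D_v f x.
Proof.
move=> Hf; rewrite (@derive_mulE (fun=> c) f) //; last exact: Cinfty_cst.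
by rewrite derive_cstE mul0r addr0.
Qed.

Lemma derive_coordE (i : 'I_n) v x : 'D_v (fun z : 'rV[R]_n => z 0 i) x = v 0 i.
Proof.
have [_ ->] := @is_derive_coord R n id x v i 1 (is_derive_id _ _).
by rewrite mulr1.
Qed.

Lemma dird_add s f g : Cinfty f -> Cinfty g ->
  dird s (fun x => f x + g x) = fun x => dird s f x + dird s g x.
Proof.
move=> Hf Hg; elim: s => //= v s ->; apply/funext => x.
by rewrite derive_addE //; exact: Cinfty_dird.
Qed.

Lemma dird_scale s c f : Cinfty f ->
  dird s (fun x => c * f x) = fun x => c * dird s f x.
Proof.
move=> Hf; elim: s => //= v s ->; apply/funext => x.
by rewrite derive_scaleE //; exact: Cinfty_dird.
Qed.

Lemma dird_sub s f g : Cinfty f -> Cinfty g ->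
  dird s (fun x => f x - g x) = fun x => dird s f x - dird s g x.
Proof.
move=> Hf Hg.
have e f1 g1 : (fun x => f1 x - g1 x : R) = (fun x : 'rV[R]_n => f1 x + -1 * g1 x).
  by apply/funext => x; rewrite mulN1r.
rewrite e dird_add //; last by apply: Cinfty_mul => //; exact: Cinfty_cst.
by rewrite dird_scale // -e.
Qed.

Lemma fdiff_cat h s t f : fdiff h (s ++ t) f = fdiff h s (fdiff h t f).
Proof. exact: foldr_cat. Qed.

Lemma fdiff_perm h s t f : perm_eq s t -> fdiff h s f = fdiff h t f.
Proof.
apply: foldr_perm => u v b; apply/funext => x.
by rewrite [x + _ + _]addrAC; ring.
Qed.

Lemma fdiff_rcons h s v f :
  fdiff h (v :: s) f = fdiff h s (fun x => f (x + h *: v) - f x).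
Proof. by rewrite -[RHS](fdiff_cat h s [:: v]); apply: fdiff_perm; rewrite perm_sym perm_catC. Qed.

(** The new difference is taken innermost, by [fdiff_rcons]. Taken outermost, it would subtract two
    mean values at unrelated intermediate points. *)
Lemma fdiff_mean h s f x : Cinfty f ->
  exists2 y, `|y - x| <= `|h| * \sum_(v <- s) `|v| &
    fdiff h s f x = h ^+ size s * dird s f y.
Proof.
elim: s f x => [|v s IH] f x Hf.
  by exists x; rewrite ?subrr ?normr0 ?big_nil ?mulr0 // expr0 mul1r.
rewrite fdiff_rcons.
have Hg : Cinfty (fun z => f (z + h *: v)) by exact: Cinfty_translate.
have [y yx ->] := IH (fun x => f (x + h *: v) - f x) x (Cinfty_sub Hg Hf).
rewrite dird_sub // dird_translate //.
have Hd := Cinfty_dird s Hf.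
have [t th ->] := dir_MVT y h (fun z => Cinfty_derivable Hd z v).
exists (y + t *: v); last by rewrite /= mulrA exprSr.
rewrite addrAC big_cons mulrDr addrC; apply: (le_trans (ler_normD _ _)).
by rewrite lerD // normrZ ler_wpM2r.
Qed.

End Words.

(** The evaluation point may depend on h in any way: it is forced to x at rate h C, and continuity
    of F at x does the rest. The limit is one-sided because the mean value of a beam is available
    for positive h. *)
Lemma mean_value_limit (R : realType) (V : normedModType R) (F : V -> R)
    (Q : R -> R) (x : V) (C : R) (N : nat) :
  {for x, continuous F} ->
  (forall h, 0 < h -> exists2 y, `|y - x| <= h * C & Q h = h ^+ N * F y) ->
  (h ^- N * Q h) @[h --> 0^'+] --> F x.
Proof.
move=> cF HQ; apply/cvgrPdist_lt => e e0.
have /cvgrPdist_lt/(_ _ e0) /nbhs_ballP[d d0 H] := cF.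
near=> h.
have h0 : 0 < h by near: h; exact: nbhs_right_gt.
have [y yx ->] := HQ _ h0.
rewrite mulKf ?expf_neq0 ?gt_eqF //; apply: H.
rewrite -ball_normE /ball_ /= distrC.
apply: (le_lt_trans yx).
have C0 : 0 < `|C| + 1 by rewrite ltr_wpDl.
apply: (@le_lt_trans _ _ (h * (`|C| + 1))).
  rewrite ler_pM2l // (le_trans (ler_norm _)) // lerDl //.
rewrite -ltr_pdivlMr //.
by near: h; apply: nbhs_right_lt; rewrite divr_gt0.
Unshelve. all: by end_near. Qed.

(* Schwarz's theorem for words: the iterated differences [fdiff h s f], whose
   scaled limit is [dird s f], do not depend on the order of [s]. *)
Lemma dird_perm (R : realType) (n : nat) (s t : seq 'rV[R]_n) (f : 'rV[R]_n -> R) :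
  Cinfty f -> perm_eq s t -> dird s f = dird t f.
Proof.
move=> Hf st; apply/funext => x.
have L (r : seq 'rV[R]_n) :
    (h ^- size r * fdiff h r f x) @[h --> 0^'+] --> dird r f x.
  apply: (@mean_value_limit _ _ _ _ _ (\sum_(v <- r) `|v|)).
    exact: (Cinfty_continuous (Cinfty_dird r Hf)).
  by move=> h h0; have [y yx e] := fdiff_mean h r x Hf; exists y => //;
    rewrite -[h in leRHS]gtr0_norm.
have := L t; rewrite -(perm_size st).
under eq_fun do rewrite -(fdiff_perm _ _ st).
by move=> Lt; apply: cvg_unique Lt => //; exact: L.
Qed.

Lemma dirdC (R : realType) (n : nat) (v : 'rV[R]_n) (s : seq 'rV[R]_n) (f : 'rV[R]_n -> R) :
  Cinfty f -> (fun x => 'D_v (dird s f) x) = dird s (fun x => 'D_v f x).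
Proof.
move=> Hf; rewrite -[RHS](dird_cat s [:: v]).
change (dird (v :: s) f = dird (s ++ [:: v]) f).
by apply: dird_perm => //; rewrite -cat1s perm_catC.
Qed.

(** * Functions of bounded support and grid averages *)

(** An explicit radius, in place of a compact closure, can be tracked through translations and
    compared with the size of the grid box. *)
Definition vanish (R : realType) (n : nat) (M : R) (f : 'rV[R]_n -> R) :=
  forall x, M < `|x| -> f x = 0.

Lemma closed_normr_le (R : realType) (n : nat) (M : R) :
  closed [set x : 'rV[R]_n | `|x| <= M].
Proof.
have -> : [set x : 'rV[R]_n | `|x| <= M] = (fun x => `|x|) @^-1` [set r : R | r <= M] by [].
by apply: closed_comp; [move=> x _; exact: norm_continuous|exact: closed_le].
Qed.

Lemma compact_normr_le (R : realType) (n : nat) (M : R) :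
  compact [set x : 'rV[R]_n | `|x| <= M].
Proof.
apply: bounded_closed_compact; last exact: closed_normr_le.
exists M; split; first exact: num_real.
by move=> r Mr x /= /le_trans; apply; exact: ltW.
Qed.

Lemma Ccinfty_vanish (R : realType) (n : nat) (f : 'rV[R]_n -> R) :
  Ccinfty f -> exists2 M, 0 < M & vanish M f.
Proof.
move=> [_ /compact_bounded [M [Mr HM]]].
exists (`|M| + 1); first by rewrite ltr_wpDl.
move=> x xM; apply/eqP/negPn/negP => fx.
have /(HM (`|M| + 1)) : M < `|M| + 1 by rewrite (le_lt_trans (ler_norm _)) // ltrDl.
have clx : closure [set x | f x != 0] x by exact: subset_closure.
by move=> /(_ x clx) /=; rewrite leNgt xM.
Qed.

Lemma vanish_Ccinfty (R : realType) (n : nat) (M : R) (f : 'rV[R]_n -> R) :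
  Cinfty f -> vanish M f -> Ccinfty f.
Proof.
move=> Hf vf; split => //.
refine (subclosed_compact (@closed_closure _ _) (@compact_normr_le R n M) _).
rewrite [X in _ `<=` X](closure_id _).1; last exact: closed_normr_le.
apply: closure_subset => x /= fx; rewrite leNgt; apply/negP => /vf f0.
by rewrite f0 eqxx in fx.
Qed.

(** Compactness gives a modulus on the ball of radius M + 1. Capping it at 1 settles the remaining
    pairs: if x lies outside that ball, then x and y both lie outside the ball of radius M, where f
    is 0. *)
Lemma vanish_unif_continuous (R : realType) (n : nat) (M : R) (f : 'rV[R]_n -> R) :
  continuous f -> vanish M f ->
  forall e, 0 < e -> exists2 d, 0 < d & forall x y, `|x - y| < d -> `|f x - f y| < e.
Proof.
move=> cf vf e e0.
have /compact_near_coveringP cK := @compact_normr_le R n (M + 1).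
pose P (d : R) (x : 'rV[R]_n) := forall y, `|x - y| < d -> `|f x - f y| < e.
have [] := cK R (0^'+) P _.
  move=> x _.
  have /cvgrPdist_lt/(_ (e / 2)) := cf x.
  rewrite divr_gt0 // => /(_ isT) /nbhs_ballP[r r0 H].
  exists (ball x (r / 2), [set d : R | d < r / 2]).
    split; first by apply: nbhsx_ballx; rewrite divr_gt0.
    by apply: nbhs_right_lt; rewrite divr_gt0.
  move=> [x' d] [/= xx' dr] y x'y.
  rewrite (_ : f x' - f y = (f x - f y) - (f x - f x')); last by ring.
  rewrite (le_lt_trans (ler_normB _ _)) // [e]splitr ltrD //.
    apply: H; rewrite -ball_normE /ball_ /= -[x](subrK x') -addrA.
    move: xx'; rewrite -ball_normE /ball_ /= => xx'.
    by rewrite (le_lt_trans (ler_normD _ _)) // [r]splitr ltrD // (lt_trans x'y).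
  apply: H; move: xx'; rewrite -!ball_normE /ball_ /= => xx'.
  by rewrite (lt_trans xx') // ltr_pdivrMr // ltr_pMr // ltr1n.
move=> d0 /= d00 H.
pose d := Num.min 1 (d0 / 2).
have dpos : 0 < d by rewrite lt_min ltr01 divr_gt0.
have Kd : [set x : 'rV[R]_n | `|x| <= M + 1] `<=` P d.
  apply: H => //=.
  by rewrite sub0r normrN gtr0_norm // gt_min ltr_pdivrMr // ltr_pMr // ltr1n orbT.
exists d => // x y xy.
have [/Kd /(_ y xy) //|xM] := leP `|x| (M + 1).
have yM : M < `|y|.
  have : `|x| <= `|y| + `|x - y| by rewrite -[x in leLHS](subrK y) addrC ler_normD.
  have : `|x - y| < 1 by rewrite (lt_le_trans xy) // ge_min lexx.
  lra.
by rewrite (vf y yM) (vf x) ?subrr ?normr0 // (lt_trans _ xM) // ltrDl.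
Qed.

(** * Grid averages as a substitute for integration over a box *)

Section Grid.
Variables (R : realType) (n : nat) (B : R).
Hypothesis B0 : 0 < B.
Implicit Types (F G : 'rV[R]_n -> R).

Definition gridpt (K : nat) (k : {ffun 'I_n -> 'I_K}) : 'rV[R]_n :=
  \row_i (- B + 2 * B * (k i)%:R / K%:R).

(* Averages over a grid of the box [-B, B[^n replace the n-dimensional integral:
   all that is needed is that those of a partial derivative tend to 0 and those of
   a nonzero square do not. *)
Definition gridavg (K : nat) F : R :=
  K%:R ^- n * \sum_(k : {ffun 'I_n -> 'I_K}) F (gridpt k).

(** This stands for the statement that the integral of F over the box is 0; [K.+1] keeps the number
    of points per axis positive. *)
Definition null F := gridavg K.+1 F @[K --> \oo] --> (0 : R).

Lemma gridavgD K F G : gridavg K (fun x => F x + G x) = gridavg K F + gridavg K G.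
Proof. by rewrite /gridavg big_split mulrDr. Qed.

Lemma gridavgZ K c F : gridavg K (fun x => c * F x) = c * gridavg K F.
Proof. by rewrite /gridavg -mulr_sumr mulrCA. Qed.

Lemma nullD F G : null F -> null G -> null (fun x => F x + G x).
Proof.
move=> HF HG; rewrite /null; under eq_fun do rewrite gridavgD.
by have := cvgD HF HG; rewrite addr0; exact.
Qed.

Lemma nullZ c F : null F -> null (fun x => c * F x).
Proof.
move=> HF; rewrite /null; under eq_fun do rewrite gridavgZ.
by have := cvgM (cvg_cst c) HF; rewrite mulr0; exact.
Qed.

Lemma nullB F G : null F -> null G -> null (fun x => F x - G x).
Proof.
move=> HF HG.
have -> : (fun x => F x - G x) = (fun x => F x + -1 * G x).
  by apply/funext => x; rewrite mulN1r.
by apply: nullD => //; exact: nullZ.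
Qed.

Lemma norm_coord_le (x : 'rV[R]_n) (i : 'I_n) : `|x 0 i| <= `|x|.
Proof.
by rewrite [leRHS]mx_normrE; apply/bigmax_geP; right; exists (0, i).
Qed.

Lemma gridavg_le K F (e : R) : 0 <= e -> (forall x, `|F x| <= e) ->
  `|gridavg K.+1 F| <= e.
Proof.
move=> e0 HF; rewrite /gridavg normrM.
have K0 : 0 < K.+1%:R ^- n :> R by rewrite invr_gt0 exprn_gt0.
rewrite gtr0_norm // mulrC ler_pdivrMr ?exprn_gt0 //.
apply: (le_trans (ler_norm_sum _ _ _)).
apply: (@le_trans _ _ (\sum_(k : {ffun 'I_n -> 'I_K.+1}) e)); first exact: ler_sum.
by rewrite sumr_const card_ffun !card_ord -natrX mulr_natr.
Qed.

(* A function supported inside the box may be regarded as periodic, so that a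
   translation by one grid step permutes its values on the grid. *)
Lemma gridavg_shift M F (i : 'I_n) K : M < B -> vanish M F ->
  gridavg K.+1 (fun x => F (x + (2 * B / K.+1%:R) *: delta_mx 0 i)) = gridavg K.+1 F.
Proof.
move=> MB vF; rewrite /gridavg; congr (_ * _).
pose s (k : {ffun 'I_n -> 'I_K.+1}) : {ffun 'I_n -> 'I_K.+1} :=
  [ffun j => if j == i then ordS (k j) else k j].
pose s' (k : {ffun 'I_n -> 'I_K.+1}) : {ffun 'I_n -> 'I_K.+1} :=
  [ffun j => if j == i then ord_pred (k j) else k j].
have ss' : cancel s s'.
  by move=> k; apply/ffunP => j; rewrite !ffunE; case: eqP => // _; rewrite ordSK.
have s's : cancel s' s.
  by move=> k; apply/ffunP => j; rewrite !ffunE; case: eqP => // _; rewrite ord_predK.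
rewrite [RHS](reindex s) /=; last by exists s' => k _; [exact: ss'|exact: s's].
apply: eq_bigr => k _.
have K0 : K.+1%:R != 0 :> R by rewrite pnatr_eq0.
have [kK|kK] := ltnP (k i) K.
  congr F; apply/rowP => j; rewrite !mxE /s !ffunE eqxx /=.
  have [->|ji] := eqVneq j i; last by rewrite mulr0 addr0.
  rewrite /ordS /= modn_small // mulr1 -addrA; congr (_ + _).
  by rewrite -[(k i).+1]addn1 natrD; field.
(* The wrap-around: the shifted point has i-th coordinate B, while the point with the next cyclic
   index has i-th coordinate -B. Both lie outside the support, so both values are 0. *)
have kE : k i = K :> nat.
  by apply/eqP; rewrite eqn_leq kK andbT -ltnS ltn_ord.
rewrite !vF //.
  apply: (lt_le_trans MB); apply: le_trans (norm_coord_le _ i).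
  by rewrite /gridpt !mxE ffunE eqxx /ordS /= kE modnn mulr0 mul0r addr0 normrN gtr0_norm.
apply: (lt_le_trans MB); apply: le_trans (norm_coord_le _ i).
rewrite !mxE eqxx /= kE (_ : _ + _ = B) ?gtr0_norm //.
by rewrite eqxx mulr1 -[K.+1]addn1 natrD in K0 *; field.
Qed.

(** With h equal to the grid step, the difference quotient of F has grid average exactly 0 by
    [gridavg_shift]. Subtracting it from the derivative leaves a difference of two values of the
    derivative at distance at most h, which is uniformly small. *)
Lemma null_derive M F (i : 'I_n) : M < B -> Cinfty F -> vanish M F ->
  vanish M (fun x => 'D_(delta_mx 0 i) F x) -> null (fun x => 'D_(delta_mx 0 i) F x).
Proof.
move=> MB HF vF vD.
set G := fun x => 'D_(delta_mx 0 i) F x.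
have cG : continuous G by apply: Cinfty_continuous; exact: Cinfty_derive.
apply/cvgrPdist_le => e e0.
have [d d0 Hd] := vanish_unif_continuous cG vD e0.
near=> K.
set h := 2 * B / K.+1%:R.
have h0 : 0 < h by rewrite divr_gt0 // mulr_gt0.
have -> : gridavg K.+1 G =
    gridavg K.+1 (fun x => G x + - h^-1 * (F (x + h *: delta_mx 0 i) + -1 * F x)).
  rewrite gridavgD (gridavgZ _ (- h^-1)) gridavgD gridavgZ.
  by rewrite (gridavg_shift _ _ MB vF) mulN1r subrr mulr0 addr0.
rewrite sub0r normrN; apply: gridavg_le; first exact: ltW.
move=> x.
have [t th] := dir_MVT x h (fun z => Cinfty_derivable HF z (delta_mx 0 i)).
rewrite mulN1r => ->; rewrite mulNr mulKf ?gt_eqF //.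
apply/ltW/Hd; rewrite opprD addrA subrr add0r normrN normrZ.
have n1 : `|delta_mx 0 i : 'rV[R]_n| <= 1.
  rewrite [leLHS]mx_normrE; apply: bigmax_le => // -[a b] _ /=; rewrite mxE.
  by case: (_ && _); rewrite ?normr1 // normr0.
apply: (@le_lt_trans _ _ h).
  by rewrite -[leRHS](mulr1 h) ler_pM // (le_trans th) // gtr0_norm.
rewrite /h ltr_pdivrMr // -ltr_pdivrMl //.
apply: (@lt_trans _ _ K%:R); last by rewrite ltr_nat.
by near: K; exact: nbhs_infty_gtr.
Unshelve. all: by end_near. Qed.

Lemma null_ge0_eq0 F : continuous F -> (forall x, 0 <= F x) -> null F ->
  forall x, `|x| < B -> F x = 0.
Proof.
move=> cF F0 nF x xB.
apply/eqP; rewrite eq_le F0 andbT leNgt; apply/negP => Fx.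
have /cvgrPdist_lt/(_ (F x / 2)) := cF x.
rewrite divr_gt0 // => /(_ isT) /nbhs_ballP[r r0 Hr].
(* A coarse subdivision into L cells per axis, of side less than r: the cell with indices [a i]
   contains x and lies in the ball where F exceeds F(x)/2. *)
have [L L0 LB] : exists2 L : nat, (0 < L)%N & 2 * B / L%:R < r.
  exists (Num.truncn (r^-1 * (2 * B))).+1 => //.
  by rewrite ltr_pdivrMr // -ltr_pdivrMl // truncnS_gt.
have LR : 0 < L%:R :> R by rewrite ltr0n.
have xi i : - B < x 0 i < B.
  by rewrite -ltr_norml (le_lt_trans (norm_coord_le _ _)).
have B2 : 0 < 2 * B by rewrite mulr_gt0.
pose a i := Num.truncn ((x 0 i + B) * L%:R / (2 * B)).
have a0 i : 0 <= (x 0 i + B) * L%:R / (2 * B).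
  have /andP[x1 x2] := xi i.
  by rewrite divr_ge0 ?(ltW B2) // mulr_ge0 ?(ltW LR) //; lra.
have aL i : (a i < L)%N.
  rewrite -(ltr_nat R); have /andP[/le_lt_trans -> //] := truncn_itv (a0 i).
  have /andP[x1 x2] := xi i.
  by rewrite ltr_pdivrMr // mulrC ltr_pM2l //; lra.
have /cvgrPdist_lt/(_ (F x / 2 / L%:R ^+ n)) := nF.
rewrite !divr_gt0 ?exprn_gt0 // => /(_ isT) [N _ HN].
(* A grid with L q points per axis puts q^n of them into this cell, so its average is at least L^-n
   F(x)/2, whatever q is. Since [null] samples at [K.+1], the index used is L q - 1, which is at
   least N. *)
pose q := N.+1.
have KE : (L * q).-1.+1 = (L * q)%N by rewrite prednK // muln_gt0 L0.
have /HN : (N <= (L * q).-1)%N by rewrite -ltnS KE (leq_trans _ (leq_pmull _ L0)).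
rewrite /= KE sub0r normrN ltNge => /negP; apply.
rewrite (le_trans _ (ler_norm _)) // /gridavg.
have q0 : 0 < q%:R :> R by rewrite ltr0n.
have -> : F x / 2 / L%:R ^+ n = (L * q)%:R ^- n * (F x / 2 * q%:R ^+ n).
  by rewrite natrM exprMn; field; rewrite !expf_neq0 // gt_eqF.
rewrite ler_pM2l ?invr_gt0 ?exprn_gt0 ?natrM ?mulr_gt0 //.
have bnd (j : {ffun 'I_n -> 'I_q}) i : (a i * q + j i < L * q)%N.
  apply: (@leq_trans ((a i).+1 * q)); last by rewrite leq_mul2r aL orbT.
  by rewrite mulSn addnC ltn_add2r.
pose emb (j : {ffun 'I_n -> 'I_q}) : {ffun 'I_n -> 'I_(L * q)} :=
  [ffun i => Ordinal (bnd j i)].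
have inj : injective emb.
  move=> j1 j2 /ffunP e; apply/ffunP => i; apply/val_inj.
  by have := e i; rewrite !ffunE => /(congr1 val) /= /addnI.
have Femb j : F x / 2 <= F (gridpt (emb j)).
  have : `|F x - F (gridpt (emb j))| < F x / 2.
    apply: Hr; rewrite -ball_normE /ball_ /= [ltLHS]mx_normrE.
    apply: bigmax_lt => // -[z i] _ /=; rewrite ord1 !mxE ffunE /=.
    have /andP[x1 x2] := xi i.
    have /andP[t1 t2] := truncn_itv (a0 i); rewrite -/(a i) in t1 t2.
    rewrite ler_pdivlMr // in t1; rewrite ltr_pdivrMr // in t2.
    have qR : q%:R != 0 :> R by rewrite gt_eqF.
    have LnR : L%:R != 0 :> R by rewrite gt_eqF.
    apply: le_lt_trans LB.
    have -> : x 0 i - (- B + 2 * B * (a i * q + j i)%:R / (L * q)%:R) =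
      ((x 0 i + B) * L%:R - (a i)%:R * (2 * B) - 2 * B * ((j i)%:R / q%:R)) / L%:R.
      by rewrite natrD !natrM; field; rewrite LnR qR.
    rewrite normrM [`|L%:R^-1|]gtr0_norm ?invr_gt0 // ler_pM2r ?invr_gt0 //.
    set y := (x 0 i + B) * L%:R in t1 t2 *.
    have jq0 : 0 <= 2 * B * ((j i)%:R / q%:R) by rewrite mulr_ge0 ?(ltW B2) // divr_ge0.
    have jq1 : 2 * B * ((j i)%:R / q%:R) <= 2 * B.
      by rewrite ger_pMr // ler_pdivrMr // mul1r ler_nat ltnW.
    rewrite -[(a i).+1]addn1 natrD mulrDl mul1r in t2.
    by rewrite ler_norml; apply/andP; split; lra.
  by rewrite ltr_norml => /andP[h1 h2]; lra.
pose A := [set k : {ffun 'I_n -> 'I_(L * q)} | F x / 2 <= F (gridpt k)]%SET.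
apply: (@le_trans _ _ (\sum_(k in A) F (gridpt k))); last first.
  by rewrite [leRHS](bigID (mem A)) /= lerDl sumr_ge0.
apply: (@le_trans _ _ (\sum_(k in A) (F x / 2))); last first.
  by apply: ler_sum => k; rewrite inE.
rewrite sumr_const -[leRHS]mulr_natr ler_pM2l ?divr_gt0 // -natrX ler_nat.
have -> : (q ^ n = #|[set: {ffun 'I_n -> 'I_q}]%SET|)%N.
  by rewrite cardsT card_ffun !card_ord.
rewrite -(card_imset _ inj) subset_leq_card //; apply/fintype.subsetP => k /imsetP[j _ ->].
by rewrite inE.
Qed.

End Grid.

(** * Polynomial differential operators *)

Definition word (T : Type) (m : nat) (u : 'I_m -> T) (k : 'I_m -> nat) : seq T :=
  flatten [seq nseq (k i) (u i) | i <- enum 'I_m].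

(** Permutations of words are all established by counting, which makes the order of the letters
    irrelevant. *)
Lemma count_word (T : Type) (m : nat) (u : 'I_m -> T) (k : 'I_m -> nat) (a : pred T) :
  count a (word u k) = (\sum_i a (u i) * k i)%N.
Proof.
rewrite count_flatten -map_comp sumnE big_map big_enum /=.
by apply: eq_bigr => i _; rewrite count_nseq.
Qed.

Lemma perm_wordD (T : eqType) (m : nat) (u : 'I_m -> T) (j k : 'I_m -> nat) :
  perm_eq (word u (fun i => j i + k i)%N) (word u j ++ word u k).
Proof.
apply/permP => a; rewrite count_cat !count_word -big_split /=.
by apply: eq_bigr => i _; rewrite mulnDr.
Qed.

Lemma perm_word1 (T : eqType) (m : nat) (u : 'I_m -> T) (i : 'I_m) :
  perm_eq (word u (fun j => (i == j) : nat)) [:: u i].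
Proof.
apply/permP => a; rewrite count_word (bigD1 i) //= eqxx muln1 big1 ?addn0 // => j ji.
by rewrite eq_sym (negbTE ji) muln0.
Qed.

Lemma eq_word (T : Type) (m : nat) (u : 'I_m -> T) (j k : 'I_m -> nat) :
  j =1 k -> word u j = word u k.
Proof. by move=> jk; congr flatten; apply: eq_map => i; rewrite jk. Qed.

Lemma iter_derivE (R : realType) (n m : nat) (u : 'I_m -> 'rV[R]_n)
    (k : 'I_m -> nat) (f : 'rV[R]_n -> R) :
  iter_deriv u k f = dird (word u k) f.
Proof.
rewrite /iter_deriv /word; elim: (enum _) => //= i s ->.
by rewrite dird_cat; elim: (k i) => //= a ->.
Qed.

Section LinearExtension.
Variables (R : realType) (m : nat).
Implicit Types (p q : mpoly.mpoly m R) (phi : mpoly.multinom m -> R).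

(** The linear extension of a function on monomials. [poly_deriv] at a point is an instance, and its
    linearity in the polynomial, hidden by the sum over the support, comes from here. *)
Definition mlin phi p : R := \sum_(k <- mpoly.msupp p) mpoly.mcoeff k p * phi k.

Lemma mlin_subset phi p (s : seq (mpoly.multinom m)) :
  uniq s -> {subset mpoly.msupp p <= s} ->
  mlin phi p = \sum_(k <- s) mpoly.mcoeff k p * phi k.
Proof.
move=> us sub; rewrite [RHS](bigID (mem (mpoly.msupp p))) /=.
rewrite [X in _ + X]big1 ?addr0; last first.
  by move=> k kp; rewrite mpoly.memN_msupp_eq0 // mul0r.
rewrite -big_filter; apply: perm_big; apply: uniq_perm.
- exact: mpoly.msupp_uniq.
- exact: filter_uniq.
- by move=> k; rewrite mem_filter /= andb_idr // => /sub.
Qed.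

Lemma mlin0 phi : mlin phi 0 = 0.
Proof. by rewrite /mlin mpoly.msupp0 big_nil. Qed.

Lemma mlinD phi p q : mlin phi (p + q) = mlin phi p + mlin phi q.
Proof.
pose s := undup (mpoly.msupp p ++ mpoly.msupp q).
have us : uniq s by exact: undup_uniq.
rewrite !(@mlin_subset phi _ s) //.
- by rewrite -big_split; apply: eq_bigr => k _; rewrite mpoly.mcoeffD mulrDl.
- by move=> k kq; rewrite mem_undup mem_cat kq orbT.
- by move=> k kp; rewrite mem_undup mem_cat kp.
- by move=> k /mpoly.msuppD_le; rewrite mem_undup.
Qed.

Lemma mlinZ phi c p : mlin phi (c *: p) = c * mlin phi p.
Proof.
rewrite (@mlin_subset phi _ (mpoly.msupp p)).
- by rewrite mulr_sumr; apply: eq_bigr => k _; rewrite mpoly.mcoeffZ mulrA.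
- exact: mpoly.msupp_uniq.
- exact: mpoly.msuppZ_le.
Qed.

Lemma mlin_sum phi (I : Type) (r : seq I) (F : I -> mpoly.mpoly m R) :
  mlin phi (\sum_(i <- r) F i) = \sum_(i <- r) mlin phi (F i).
Proof. exact: (big_morph _ (mlinD phi) (mlin0 phi)). Qed.

Lemma mlinX phi k : mlin phi (mpoly.mpolyX R k) = phi k.
Proof.
by rewrite /mlin mpoly.msuppX big_seq1 mpoly.mcoeffX eqxx mul1r.
Qed.

(** Induction by one variable at a time, so that a claim about P(D) reduces to a claim about a
    single derivative. *)
Lemma mpoly_indX (K : mpoly.mpoly m R -> Prop) :
  K 0 -> K 1 -> (forall i p, K p -> K (mpoly.mpolyX R (mpoly.mnm1 i) * p)) ->
  (forall c p q, K p -> K q -> K (c *: p + q)) -> forall p, K p.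
Proof.
move=> K0 K1 KX KL; apply: mpoly.mpolyind => // c k p _ _ Kp.
apply: KL => //; rewrite mpoly.mpolyXE_id.
elim: (index_enum _) => [|i s IH]; first by rewrite big_nil.
rewrite big_cons; elim: (k i) => [|a IHa]; first by rewrite expr0 mul1r.
by rewrite exprS -mulrA; exact: KX.
Qed.

End LinearExtension.

Section PolyDeriv.
Variables (R : realType) (n m : nat) (u : 'I_m -> 'rV[R]_n).
Implicit Types (f g : 'rV[R]_n -> R) (p q : mpoly.mpoly m R).

Lemma poly_deriv0 f : poly_deriv 0 u f = fun=> 0.
Proof. by apply/funext => x; exact: mlin0. Qed.

Lemma poly_deriv_lin c p q f :
  poly_deriv (c *: p + q) u f = fun x => c * poly_deriv p u f x + poly_deriv q u f x.
Proof. by apply/funext => x; rewrite /poly_deriv -/(mlin _ _) mlinD mlinZ. Qed.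

Lemma poly_derivX k f : poly_deriv (mpoly.mpolyX R k) u f = dird (word u k) f.
Proof. by apply/funext => x; rewrite -iter_derivE; exact: mlinX. Qed.

Lemma poly_deriv1 f : poly_deriv 1 u f = f.
Proof.
rewrite -mpoly.mpolyX0 poly_derivX (@eq_word _ _ _ _ (fun=> 0%N)).
  by rewrite /word; elim: (enum _).
by move=> i; rewrite mpoly.mnm0E.
Qed.

Lemma Cinfty_poly_deriv p f : Cinfty f -> Cinfty (poly_deriv p u f).
Proof.
move=> Hf; apply: Cinfty_sum => k; apply: Cinfty_mul; first exact: Cinfty_cst.
by rewrite iter_derivE; exact: Cinfty_dird.
Qed.

Lemma poly_deriv_mulX i p f : Cinfty f ->
  poly_deriv (mpoly.mpolyX R (mpoly.mnm1 i) * p) u f =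
  fun x => 'D_(u i) (poly_deriv p u f) x.
Proof.
move=> Hf; elim/mpoly.mpolyind: p => [|c k p _ _ IH].
  by rewrite mulr0 poly_deriv0; apply/funext => x; rewrite derive_cstE.
rewrite mulrDr -scalerAr !poly_deriv_lin IH; apply/funext => x.
rewrite derive_addE; last 2 first.
- by apply: Cinfty_mul; [exact: Cinfty_cst|exact: Cinfty_poly_deriv].
- exact: Cinfty_poly_deriv.
rewrite (derive_scaleE _ _ _ (Cinfty_poly_deriv _ Hf)); congr (_ * _ + _).
rewrite -mpoly.mpolyXD !poly_derivX.
have -> : dird (word u (mpoly.mnm_add (mpoly.mnm1 i) k)) f = dird (u i :: word u k) f.
  apply: dird_perm => //.
  rewrite (@eq_word _ _ _ _ (fun j => (i == j) + k j)%N); last first.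
    by move=> j; rewrite mpoly.mnmDE mpoly.mnm1E.
  by rewrite (perm_trans (perm_wordD _ _ _)) // -cat1s perm_cat2r perm_word1.
by [].
Qed.

Lemma derive_poly_derivC p v f : Cinfty f ->
  (fun x => 'D_v (poly_deriv p u f) x) = poly_deriv p u (fun x => 'D_v f x).
Proof.
move=> Hf; have Hv := Cinfty_derive v Hf.
elim/mpoly_indX: p => [||i p IH|c p q IHp IHq].
- by rewrite !poly_deriv0; apply/funext => x; rewrite derive_cstE.
- by rewrite !poly_deriv1.
- rewrite !poly_deriv_mulX // -IH.
  exact: (@dirdC _ _ v [:: u i] _ (Cinfty_poly_deriv p Hf)).
- rewrite !poly_deriv_lin -IHp -IHq; apply/funext => x.
  rewrite derive_addE; last 2 first.
  + by apply: Cinfty_mul; [exact: Cinfty_cst|exact: Cinfty_poly_deriv].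
  + exact: Cinfty_poly_deriv.
  by rewrite (derive_scaleE _ _ _ (Cinfty_poly_deriv _ Hf)).
Qed.

Lemma poly_deriv_mul p q f : Cinfty f ->
  poly_deriv (p * q) u f = poly_deriv p u (poly_deriv q u f).
Proof.
move=> Hf; have Hq := Cinfty_poly_deriv q Hf.
elim/mpoly_indX: p => [||i p IH|c p p' IH IH'].
- by rewrite mul0r !poly_deriv0.
- by rewrite mul1r !poly_deriv1.
- by rewrite -mulrA !poly_deriv_mulX // IH.
- by rewrite mulrDl -scalerAl !poly_deriv_lin IH IH'.
Qed.

Lemma poly_derivC p q f : Cinfty f ->
  poly_deriv p u (poly_deriv q u f) = poly_deriv q u (poly_deriv p u f).
Proof. by move=> Hf; rewrite -!poly_deriv_mul // mulrC. Qed.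

Lemma poly_deriv_cst0 p : poly_deriv p u (fun=> 0) = fun=> 0.
Proof.
have H0 := @Cinfty_cst R n 0.
elim/mpoly_indX: p => [||i p IH|c p q IHp IHq].
- by rewrite poly_deriv0.
- by rewrite poly_deriv1.
- by rewrite poly_deriv_mulX // IH; apply/funext => x; rewrite derive_cstE.
- by rewrite poly_deriv_lin IHp IHq; apply/funext => x; rewrite mulr0 addr0.
Qed.

End PolyDeriv.

Local Notation unit_vec R n := (fun i : 'I_n => delta_mx 0 i : 'rV[R]_n).

(** P is q with the linear form of u_i substituted for the i-th variable. Linearly dependent branch
    vectors may make P zero although q is not, so the hypothesis on L has to be read on P. *)
Lemma poly_deriv_symbol (R : realType) (n m : nat) (u : 'I_m -> 'rV[R]_n)
    (q : mpoly.mpoly m R) :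
  exists P : mpoly.mpoly n R, forall f, Cinfty f ->
    poly_deriv q u f = poly_deriv P (unit_vec R n) f.
Proof.
elim/mpoly_indX: q => [||i q [P HP]|c p q [P HP] [Q HQ]].
- by exists 0 => f _; rewrite !poly_deriv0.
- by exists 1 => f _; rewrite !poly_deriv1.
- exists (\sum_j u i 0 j *: (mpoly.mpolyX R (mpoly.mnm1 j) * P)) => f Hf.
  rewrite poly_deriv_mulX // HP //; apply/funext => x.
  rewrite Cinfty_deriveE; last exact: Cinfty_poly_deriv.
  rewrite [RHS]/poly_deriv -/(mlin _ _) mlin_sum; apply: eq_bigr => j _.
  rewrite mlinZ; congr (_ * _).
  change ('D_(delta_mx 0 j) (poly_deriv P (unit_vec R n) f) x =
    poly_deriv (mpoly.mpolyX R (mpoly.mnm1 j) * P) (unit_vec R n) f x).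
  by rewrite poly_deriv_mulX.
- by exists (c *: P + Q) => f Hf; rewrite !poly_deriv_lin HP // HQ.
Qed.

Lemma vanish_derive (R : realType) (n : nat) (M : R) (f : 'rV[R]_n -> R) (v : 'rV[R]_n) :
  vanish M f -> vanish M (fun x => 'D_v f x).
Proof.
move=> vf x Mx.
have nx : \near x, f x = 0.
  have : \near x, M < `|x|.
    have : nbhs `|x| [set r : R | M < r] by exact: lt_nbhsr.
    exact: (@norm_continuous _ _ x).
  by apply: filterS => y; exact: vf.
rewrite (@near_eq_derive _ _ _ f (fun=> 0)); last exact: nx.
exact: derive_cstE.
Qed.

Lemma vanish_poly_deriv (R : realType) (n m : nat) (u : 'I_m -> 'rV[R]_n) (M : R)
    (p : mpoly.mpoly m R) (f : 'rV[R]_n -> R) :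
  Cinfty f -> vanish M f -> vanish M (poly_deriv p u f).
Proof.
move=> Hf vf; elim/mpoly_indX: p => [||i p IH|c p q IHp IHq].
- by rewrite poly_deriv0.
- by rewrite poly_deriv1.
- by rewrite poly_deriv_mulX //; exact: vanish_derive.
- by rewrite poly_deriv_lin => x Mx; rewrite IHp // IHq // mulr0 addr0.
Qed.

(** * Injectivity of constant-coefficient operators on compactly supported functions *)

Section Torsion.
Variables (R : realType) (n : nat).
Implicit Types (P : mpoly.mpoly n R) (f a b : 'rV[R]_n -> R).
Local Notation pdo P := (poly_deriv P (unit_vec R n)).

(** The commutator of P(D) with multiplication by x_j is P^(j)(D): by the product rule each factor
    D_i contributes the derivative of x_j along the i-th basis vector, which is 1 if i = j and 0
    otherwise. *)
Lemma pdo_coord P (j : 'I_n) f : Cinfty f ->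
  pdo P (fun x => x 0 j * f x) = fun x => x 0 j * pdo P f x + pdo (mpoly.mderiv j P) f x.
Proof.
move=> Hf; have Hj := Cinfty_mul (@Cinfty_coord R n j) Hf.
elim/mpoly_indX: P => [||i P IH|c P Q IHP IHQ].
- rewrite linear0 !poly_deriv0; apply/funext => x; ring.
- rewrite -[X in mpoly.mderiv j X]mpoly.mpolyC1 mpoly.mderivC !poly_deriv1 poly_deriv0.
  by apply/funext => x; rewrite addr0.
- have HP := Cinfty_poly_deriv (unit_vec R n) P Hf.
  have HP' := Cinfty_poly_deriv (unit_vec R n) (mpoly.mderiv j P) Hf.
  rewrite mpoly.mderivM mpoly.mderivX !poly_deriv_mulX // IH.
  rewrite -[(_ *: _) * P]scalerAl poly_deriv_lin (poly_deriv_mulX _ _ (mpoly.mderiv j P) Hf).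
  apply/funext => x.
  rewrite derive_addE //; last by apply: Cinfty_mul => //; exact: Cinfty_coord.
  rewrite derive_mulE //; last exact: Cinfty_coord.
  rewrite derive_coordE mxE eqxx /= eq_sym.
  rewrite -addrA mpoly.mnm1E; congr (_ + (_ + _)).
  have [->|ij] := eqVneq i j; last by rewrite !mul0r.
  rewrite !mul1r; congr (poly_deriv _ _ _ _).
  rewrite -[LHS]mul1r; congr (_ * _).
  rewrite -mpoly.mpolyX0; congr (mpoly.mpolyX _ _).
  by apply/mpoly.mnmP => l; rewrite mpoly.mnm0E mpoly.mnmBE subnn.
- rewrite linearD linearZ /= !poly_deriv_lin IHP IHQ.
  by apply/funext => x; ring.
Qed.

Variables (M B : R).
Hypotheses (M0 : 0 < M) (MB : M < B).

(** Integration by parts; P' is P(-xi). Bounded support of one factor suffices, because it passes to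
    the products that are differentiated. *)
Lemma pdo_adjoint P : exists P', forall a b, Cinfty a -> Cinfty b -> vanish M a ->
  null B (fun x => pdo P a x * b x - a x * pdo P' b x).
Proof.
have B0 : 0 < B by exact: lt_trans MB.
have null0 : null B (fun _ : 'rV[R]_n => 0).
  rewrite /null /gridavg; under eq_fun do rewrite big1 ?mulr0 //.
  exact: cvg_cst.
elim/mpoly_indX: P => [||i P [P' HP']|c P Q [P' HP'] [Q' HQ']].
- exists 0 => a b Ha Hb va; rewrite !poly_deriv0.
  by under eq_fun do rewrite mulr0 mul0r subrr.
- exists 1 => a b Ha Hb va; rewrite !poly_deriv1.
  by under eq_fun do rewrite subrr.
- exists (- 1 *: (mpoly.mpolyX R (mpoly.mnm1 i) * P') + 0) => a b Ha Hb va.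
  rewrite poly_deriv_lin !poly_deriv_mulX // poly_deriv0.
  have HPa := Cinfty_poly_deriv (unit_vec R n) P Ha.
  have vPa : vanish M (pdo P a) by exact: vanish_poly_deriv.
  have vF : vanish M (fun x => pdo P a x * b x).
    by move=> x Mx; rewrite vPa // mul0r.
  (* The derivative of (P a) b, minus the induction hypothesis for a and D_i b, is (D_i P a) b + a
     D_i P' b. This is the required expression, the adjoint of D_i P being -D_i P'. *)
  have := nullB (null_derive (i := i) B0 MB (Cinfty_mul HPa Hb) vF (vanish_derive _ vF))
     (HP' a _ Ha (Cinfty_derive (delta_mx 0 i) Hb) va).
  rewrite -derive_poly_derivC //; congr null; apply/funext => x /=.
  by rewrite derive_mulE //; ring.
- exists (c *: P' + Q') => a b Ha Hb va; rewrite !poly_deriv_lin.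
  have := nullD (nullZ c (HP' a b Ha Hb va)) (HQ' a b Ha Hb va).
  congr null; apply/funext => x; ring.
Qed.

Lemma null_sqr_eq0 f : Cinfty f -> vanish M f -> null B (fun x => f x * f x) ->
  f = fun=> 0.
Proof.
move=> Hf vf nf; apply/funext => x.
have [Mx|xM] := ltP M `|x|; first exact: vf.
have B0 : 0 < B by exact: lt_trans MB.
have /eqP := null_ge0_eq0 B0 (Cinfty_continuous (Cinfty_mul Hf Hf))
  (fun y => sqr_ge0 (f y)) nf (le_lt_trans xM MB).
by rewrite mulf_eq0 orbb => /eqP.
Qed.

(* The square norm of P^(j)(D) f = P(D)(x_j f) is <x_j f, P^(j)(D) P(D)^* f>, and
   P(D)^* f = 0 because P(D) commutes with its adjoint. *)
Lemma pdo_mderiv_eq0 P (j : 'I_n) f : Cinfty f -> vanish M f ->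
  pdo P f = (fun=> 0) -> pdo (mpoly.mderiv j P) f = fun=> 0.
Proof.
move=> Hf vf Pf.
have [P' HP'] := pdo_adjoint P.
have HP'f := Cinfty_poly_deriv (unit_vec R n) P' Hf.
have vP'f : vanish M (pdo P' f) by exact: vanish_poly_deriv.
have P'f : pdo P' f = fun=> 0.
  apply: null_sqr_eq0 => //.
  have := nullZ (- 1) (HP' _ f HP'f Hf vP'f).
  rewrite poly_derivC // Pf poly_deriv_cst0.
  by congr null; apply/funext => x; ring.
have Hj := Cinfty_mul (@Cinfty_coord R n j) Hf.
have HPj := Cinfty_poly_deriv (unit_vec R n) (mpoly.mderiv j P) Hf.
apply: null_sqr_eq0 => //; first exact: vanish_poly_deriv.
have vj : vanish M (fun x : 'rV[R]_n => x 0 j * f x) by move=> x Mx; rewrite vf // mulr0.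
have := HP' _ _ Hj HPj vj.
rewrite poly_derivC // P'f poly_deriv_cst0 pdo_coord // Pf.
by congr null; apply/funext => x; ring.
Qed.

Lemma pdo_inj P f : P != 0 -> Cinfty f -> vanish M f -> pdo P f = (fun=> 0) ->
  f = fun=> 0.
Proof.
move=> P0 Hf vf.
(* N bounds the degree strictly, so that N = 0 forces P = 0 and the base case is excluded. *)
have [N PN] : exists N, forall k, (N <= mpoly.mdeg k)%N -> mpoly.mcoeff k P = 0.
  exists (mpoly.mmeasure (@mpoly.mdeg n) P) => k /mpoly.msize_mdeg_ge.
  exact: mpoly.memN_msupp_eq0.
elim: N P P0 PN => [|N IH] P P0 PN Pf.
  by case/eqP: P0; apply/mpoly.mpolyP => k; rewrite mpoly.mcoeff0 PN.
have [[j Pj]|allj] := pselect (exists j, mpoly.mderiv j P != 0).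
  apply: (IH _ Pj); last exact: pdo_mderiv_eq0.
  move=> k Nk; rewrite mpoly.mcoeff_deriv PN ?mul0rn //.
  by rewrite mpoly.mdegD mpoly.mdeg1 addn1.
(* All partial derivatives vanish, so P is constant: a coefficient at k with k_j > 0 reappears in
   the j-th derivative multiplied by a positive integer. *)
have PC : P = mpoly.mcoeff (mpoly.mnm0) P *: 1 + 0.
  apply/mpoly.mpolyP => k; rewrite addr0 mpoly.mcoeffZ mpoly.mcoeff1.
  have [->|k0] := eqVneq k mpoly.mnm0; first by rewrite mulr1.
  rewrite mulr0.
  have [j kj] : exists j, (0 < k j)%N.
    apply: contrapT => H; case/eqP: k0; apply/mpoly.mnmP => j; rewrite mpoly.mnm0E.
    by apply/eqP; rewrite -leqn0 leqNgt; apply/negP => kj; apply: H; exists j.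
  have : mpoly.mcoeff (mpoly.mnm_sub k (mpoly.mnm1 j)) (mpoly.mderiv j P) = 0.
    have [->|Pj] := eqVneq (mpoly.mderiv j P) 0; first exact: mpoly.mcoeff0.
    by case: allj; exists j.
  rewrite mpoly.mcoeff_deriv.
  have -> : mpoly.mnm_add (mpoly.mnm_sub k (mpoly.mnm1 j)) (mpoly.mnm1 j) = k.
    apply/mpoly.mnmP => l; rewrite mpoly.mnmDE mpoly.mnmBE mpoly.mnm1E.
    by have [<-|_] := eqVneq j l; [rewrite subnK | rewrite subn0 addn0].
  by move/eqP; rewrite mulrn_eq0 => /eqP.
have c0 : mpoly.mcoeff (mpoly.mnm0) P != 0.
  by apply: contraNneq P0 => c0; rewrite PC c0 scale0r add0r.
move: Pf; rewrite PC poly_deriv_lin poly_deriv1 poly_deriv0 => Pf.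
apply/funext => x; move/(congr1 (@^~ x)): Pf => /eqP.
by rewrite /= addr0 mulf_eq0 (negbTE c0) => /eqP.
Qed.

End Torsion.

(** * A bump function *)

(* exp(-1/t) q(1/t): this family is closed under differentiation. *)
Definition flat (R : realType) (q : {poly R}) (t : R) : R :=
  if 0 < t then q.[t^-1] * expR (- t^-1) else 0.

(** The constant comes from s^i <= i! exp(s) for s > 0, applied to each term of q. *)
Lemma poly_expR_bounded (R : realType) (q : {poly R}) :
  exists2 C, 0 <= C & forall s, 0 < s -> `|q.[s]| * expR (- s) <= C.
Proof.
exists (\sum_(i < size q) `|q`_i| * i`!%:R).
  by apply: sumr_ge0 => i _; rewrite mulr_ge0.
move=> s s0; rewrite expRN ler_pdivrMr ?expR_gt0 // horner_coef mulr_suml.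
apply: (le_trans (ler_norm_sum _ _ _)); apply: ler_sum => i _.
rewrite normrM -mulrA ler_wpM2l // ger0_norm ?exprn_ge0 ?(ltW s0) //.
case: (i : nat) => [|k].
  by rewrite expr0 fact0 mul1r; apply: le_trans (expR_ge1Dx _); rewrite lerDl ltW.
have := expR_ge1Dxn k (ltW s0).
rewrite -ler_pdivrMl ?ltr0n ?fact_gt0 // mulrC; apply: le_trans.
by rewrite lerDr.
Qed.

(** With s = 1/t one has ds/dt = -s^2, and the derivative of q(s) exp(-s) in s is (q' - q)(s)
    exp(-s); hence the new polynomial X^2 (q - q'). *)
Lemma is_derive_flat (R : realType) (q : {poly R}) (t : R) :
  is_derive t (1 : R) (flat q) (flat ('X^2 * (q - q^`())) t).
Proof.
have [t0|t0|->] := ltgtP t 0.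
- rewrite {2}/flat ltNge (ltW t0) /=.
  apply: (@near_eq_is_derive _ _ _ (fun=> 0) (flat q)).
  + near=> z; rewrite /flat ltNge.
    suff -> : z <= 0 by [].
    by apply/ltW; near: z; exact: lt_nbhsl.
- rewrite {2}/flat t0.
  apply: (@near_eq_is_derive R R R (fun s : R => q.[s^-1] * expR (- s^-1)) (flat q)).
  + near=> z; rewrite /flat.
    suff -> : 0 < z by [].
    by near: z; exact: lt_nbhsr.
  + have dV : is_derive t (1 : R) (fun s : R => s^-1) (- t ^- 2).
      rewrite -[X in is_derive _ _ _ X]mulr1.
      by apply: (@is_deriveV R id t 1 1); rewrite gt_eqF.
    have dq : is_derive t (1 : R) (fun s : R => q.[s^-1]) (q^`().[t^-1] * - t ^- 2).
      have dh : is_derive t^-1 (1 : R) (horner q) q^`().[t^-1].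
        by rewrite derivE derive1E; apply: derivableP; exact: derivable_horner.
      exact: is_derive1_comp.
    have dE : is_derive t (1 : R) (fun s : R => expR (- s^-1)) (expR (- t^-1) * t ^- 2).
      apply: (@is_derive1_comp R expR (fun s => - s^-1) t).
      rewrite -[X in is_derive _ _ _ X]opprK; exact: is_deriveN.
    apply: is_derive_eq.
    have -> : ('X^2 * (q - q^`())).[t^-1] = t^-1 ^+ 2 * (q.[t^-1] - q^`().[t^-1]).
      by rewrite !hornerE.
    by rewrite /GRing.scale /=; field; rewrite gt_eqF.
- rewrite {2}/flat ltxx.
  (* At 0 the right difference quotient is q(1/h) exp(-1/h) / h. Writing q(1/h) / h as (X^2 q)(1/h)
     h bounds it by C h. *)
  have [C C0 HC] := poly_expR_bounded ('X^2 * q).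
  have H : (fun h : R => h^-1 *: ((flat q \o shift 0) (h *: (1 : R)) - flat q 0)) @ 0^' --> (0 : R).
    apply/cvgrPdist_le => e e0; near=> h.
    rewrite sub0r normrN /= addr0 {2}/flat ltxx subr0 /GRing.scale /= mulr1 /flat.
    case: ifPn => h0; last by rewrite mulr0 normr0 ltW.
    have hV : 0 < h^-1 by rewrite invr_gt0.
    have -> : h^-1 * (q.[h^-1] * expR (- h^-1)) = ('X^2 * q).[h^-1] * expR (- h^-1) * h.
      have -> : ('X^2 * q).[h^-1] = h^-1 ^+ 2 * q.[h^-1] by rewrite !hornerE.
      by field; rewrite gt_eqF.
    rewrite normrM normrM [`|h|]gtr0_norm // [`|expR _|]gtr0_norm ?expR_gt0 //.
    apply: (@le_trans _ _ ((C + 1) * h)).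
      by rewrite ler_pM2r // (le_trans (HC _ hV)) // lerDl.
    rewrite -ler_pdivlMl ?ltr_wpDl //; apply/ltW.
    rewrite -[h]gtr0_norm //; near: h; apply: nbhs_dnbhs.
    have : nbhs (0 : R) (ball (0 : R) ((C + 1)^-1 * e)).
      by apply: nbhsx_ballx; rewrite mulr_gt0 // invr_gt0 ltr_wpDl.
    by apply: filterS => h; rewrite -ball_normE /ball_ /= sub0r normrN.
  split; first by apply/cvg_ex; eexists; exact: H.
  by apply: cvg_lim => //; exact: H.
Unshelve. all: by end_near. Qed.

Lemma Cinfty_flat_coord (R : realType) (n : nat) (q : {poly R}) (a c : R) (i : 'I_n) :
  Cinfty (fun x : 'rV[R]_n => flat q (a + c * x 0 i)).
Proof.
have d (r : {poly R}) (x v : 'rV[R]_n) : is_derive x v (fun x => flat r (a + c * x 0 i))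
    (v 0 i * (flat ('X^2 * (r - r^`())) (a + c * x 0 i) * c)).
  apply: (@is_derive_coord _ _ (fun t => flat r (a + c * t))).
  apply: (@is_derive1_comp _ (flat r) (fun t => a + c * t)); first exact: is_derive_flat.
  apply: is_derive_eq. rewrite /GRing.scale /=. ring.
have cq (r : {poly R}) : continuous (fun x : 'rV[R]_n => flat r (a + c * x 0 i)).
  move=> x; apply: (@continuous_comp _ _ _ (fun x : 'rV[R]_n => a + c * x 0 i) (flat r)).
    apply: (@continuousD _ _ _ (cst a) _ x); first exact: cst_continuous.
    by apply: (@continuousM _ _ (cst c) _ x); [exact: cst_continuous|exact: coord_continuous].
  apply: differentiable_continuous; apply/derivable1_diffP.
  by have [] := is_derive_flat r (a + c * x 0 i).
move=> k; elim: k q => [|k IH] q; split => // j.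
split => [x|]; first by have [] := d q x (delta_mx 0 j).
have -> : (fun x : 'rV[R]_n => 'D_(delta_mx 0 j) (fun x : 'rV[R]_n => flat q (a + c * x 0 i)) x) =
    fun x => (delta_mx 0 j : 'rV[R]_n) 0 i * c * flat ('X^2 * (q - q^`())) (a + c * x 0 i).
  by apply/funext => x; have [_ ->] := d q x (delta_mx 0 j); ring.
by apply: Ck_mul; [exact: Ck_cst|exact: IH].
Qed.

Lemma Cinfty_prod (R : realType) (n : nat) (I : Type) (r : seq I) (F : I -> 'rV[R]_n -> R) :
  (forall i, Cinfty (F i)) -> Cinfty (fun x => \prod_(i <- r) F i x).
Proof.
move=> H; elim: r => [|i r IH].
  by under eq_fun do rewrite big_nil; exact: Cinfty_cst.
by under eq_fun do rewrite big_cons; exact: Cinfty_mul.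
Qed.

(** A product of one-dimensional bumps fits the sup norm: if |x| > 1, some coordinate exceeds 1 in
    absolute value, and one of its two factors has a negative argument. *)
Lemma bump_exists (R : realType) (n : nat) :
  exists g : 'rV[R]_n -> R, [/\ Cinfty g, vanish 1 g & g 0 != 0].
Proof.
exists (fun x => \prod_(i < n) (flat 1 (1 + 1 * x 0 i) * flat 1 (1 + -1 * x 0 i))); split.
- by apply: Cinfty_prod => i; apply: Cinfty_mul; exact: Cinfty_flat_coord.
- move=> x x1.
  have x0 : mx_norm x != 0 by rewrite gt_eqF // (lt_trans ltr01).
  have [[z i] /= e] := mx_norm_neq0 x0; rewrite ord1 in e.
  rewrite (bigD1 i) //=; apply/eqP; rewrite mulf_eq0; apply/orP; left.
  move: x1; rewrite [`|x|]e ltr_normr => /orP[h|h].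
    by rewrite mulf_eq0; apply/orP; right; rewrite /flat ifF //; apply/negbTE; rewrite -leNgt; lra.
  by rewrite mulf_eq0; apply/orP; left; rewrite /flat ifF //; apply/negbTE; rewrite -leNgt; lra.
- have flat1 : flat (1 : {poly R}) 1 != 0.
    by rewrite /flat ltr01 mulf_neq0 ?(gt_eqF (expR_gt0 _)) // hornerE oner_neq0.
  by apply/prodf_neq0 => i _; rewrite mxE !mulr0 addr0 mulf_neq0.
Qed.

(** * Divergent beam transforms *)

Section HalfLine.
Variable R : realType.
Local Notation mu := (@lebesgue_measure R).
Implicit Types (phi : R -> R) (T a : R).

Lemma restrict_halfline phi T a : (forall t, t <= T -> phi t = 0) ->
  phi \_ `]-oo, a] = phi \_ `[T, a].
Proof.
move=> phi0; apply/funext => t; rewrite !patchE.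
have [tT|tT] := leP t T; first by rewrite phi0 //; do 2 case: ifP.
suff -> : (t \in `]-oo, a]%classic) = (t \in `[T, a]%classic) by [].
by apply/idP/idP; rewrite !inE /= !in_itv /= (ltW tT).
Qed.

Lemma integrable_halfline phi T a : continuous phi ->
  (forall t, t <= T -> phi t = 0) ->
  mu.-integrable `]-oo, a] (EFin \o phi).
Proof.
move=> cphi phi0.
have i : mu.-integrable `[T, a] (EFin \o phi).
  apply: continuous_compact_integrable; first exact: segment_compact.
  exact: continuous_subspaceT.
apply/integrable_mkcond => //; rewrite restrict_EFin (restrict_halfline _ phi0) -restrict_EFin.
by apply: (integrable_mkcond _ _).1.
Qed.

Lemma Rintegral_halfline Phi phi T : T < 0 -> continuous phi ->
  (forall t, is_derive t (1 : R) Phi (phi t)) ->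
  (forall t, t <= T -> phi t = 0) -> Phi T = 0 ->
  \int[mu]_(t in `]-oo, 0]) phi t = Phi 0.
Proof.
move=> T0 cphi dPhi phi0 PhiT.
have cPhi : continuous Phi.
  by move=> t; apply: differentiable_continuous; apply/derivable1_diffP; have [] := dPhi t.
rewrite Rintegral_mkcond (restrict_halfline _ phi0) -Rintegral_mkcond /Rintegral.
rewrite (@continuous_FTC2 _ _ Phi) //.
- by rewrite PhiT sube0.
- exact: continuous_subspaceT.
- split; [by move=> t _; have [] := dPhi t
  |by apply: cvg_at_right_filter; exact: cPhi|by apply: cvg_at_left_filter; exact: cPhi].
- by move=> t _; rewrite derive1E; have [_ ->] := dPhi t.
Qed.

Lemma antiderivative phi T : continuous phi -> (forall t, t <= T -> phi t = 0) ->
  exists Phi, forall t, is_derive t (1 : R) Phi (phi t).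
Proof.
move=> cphi phi0.
exists (fun x => \int[mu]_(t in `]-oo, x]) phi t) => t.
have tt1 : t < t + 1 by rewrite ltrDl.
have FTC := @continuous_FTC1 R phi -oo%O t (t + 1) tt1
  (integrable_halfline (t + 1) cphi phi0).
have [||d e] := FTC; [exact: ltNyr|exact: cphi|].
by split => //; rewrite -derive1E.
Qed.

End HalfLine.

Section Beam.
Variables (R : realType) (n : nat).
Implicit Types (f g F G : 'rV[R]_n -> R) (x y v w : 'rV[R]_n) (s r : seq 'rV[R]_n).

Lemma line_vanish M F x v : v != 0 -> vanish M F ->
  exists2 T, T < 0 & forall t, t <= T -> F (x + t *: v) = 0.
Proof.
move=> v0 vF; have nv : 0 < `|v| by rewrite normr_gt0.
(* For t <= -T the triangle inequality gives |x + t v| >= |t| |v| - |x| >= |M| + 1 > M. *)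
pose T := (`|M| + `|x| + 1) / `|v|.
have T0 : 0 < T by rewrite divr_gt0 // ltr_wpDl // addr_ge0.
exists (- T) => [|t tT]; first by rewrite oppr_lt0.
apply: vF.
have h : `|t *: v| <= `|x + t *: v| + `|x|.
  by rewrite -[X in `|X| <= _](addrK x) [t *: v + x]addrC ler_normB.
have : `|M| + `|x| + 1 <= `|t *: v|.
  rewrite normrZ -ler_pdivrMr // -/T.
  by rewrite ler0_norm; [rewrite lerNr|rewrite (le_trans tT) // oppr_le0 ltW].
have := ler_norm M; lra.
Qed.

Lemma comp_line_continuous F x v : continuous F -> continuous (fun t : R => F (x + t *: v)).
Proof.
move=> cF t; apply: (@continuous_comp _ _ _ (fun t : R => x + t *: v) F t).
  exact: line_continuous.
exact: cF.
Qed.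

Arguments comp_line_continuous [F] x v cF : rename.

Lemma beam_integrable M F x v : v != 0 -> continuous F -> vanish M F ->
  lebesgue_measure.-integrable `]-oo, 0%R] (EFin \o (fun t : R => F (x + t *: v))).
Proof.
move=> v0 cF vF; have [T _ HT] := line_vanish x v0 vF.
apply: (integrable_halfline _ _ HT); exact: comp_line_continuous.
Qed.

Lemma beam_derive M g v : v != 0 -> Cinfty g -> vanish M g ->
  beam v (fun x => 'D_v g x) = g.
Proof.
move=> v0 Hg vg; apply/funext => x.
have [T1 T10 HT1] := line_vanish x v0 vg.
have [T2 T20 HT2] := line_vanish x v0 (vanish_derive v vg).
pose T := Num.min T1 T2.
refine (etrans (@Rintegral_halfline _ (fun t => g (x + t *: v))
  (fun t => 'D_v g (x + t *: v)) T _ _ _ _ _) _).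
- by rewrite gt_min T10.
- exact: (comp_line_continuous x v (Cinfty_continuous (Cinfty_derive v Hg))).
- by move=> t; apply: is_derive_line; exact: (Cinfty_derivable Hg).
- by move=> t tT; apply: HT2; rewrite (le_trans tT) // ge_min lexx orbT.
- by apply: HT1; rewrite ge_min lexx.
- by rewrite scale0r addr0.
Qed.

Lemma beam_translate v f y : beam v (fun x => f (x + y)) = fun x => beam v f (x + y).
Proof.
apply/funext => x; rewrite /beam; apply: eq_Rintegral => t _.
by rewrite addrAC.
Qed.

(* By translation invariance this is the integral of F (x + t v) over [0, h], so
   that it preserves continuous functions of bounded support. *)
Definition smear h v F := beam v (fdiff h [:: v] F).

(** For an antiderivative Phi of F along the line, Phi(t + h) - Phi(t) is an antiderivative of the
    differenced integrand. It is 0 at T - h, where the whole interval [t, t + h] lies in the region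
    of vanishing, so the beam equals its value at 0, and the mean value theorem applies. *)
Lemma smear_mean M F h v x : 0 < h -> v != 0 -> continuous F -> vanish M F ->
  exists2 t, `|t| <= h & smear h v F x = h * F (x + t *: v).
Proof.
move=> h0 v0 cF vF.
have [T T0 HT] := line_vanish x v0 vF.
have cphi := comp_line_continuous x v cF.
have [Phi dPhi] := antiderivative cphi HT.
have cPhi : continuous Phi.
  by move=> t; apply: differentiable_continuous; apply/derivable1_diffP; have [] := dPhi t.
pose Psi t := Phi (t + h) - Phi t.
have mvt t : exists2 c, c \in `[t, t + h] & Psi t = F (x + c *: v) * h.
  have th : t <= t + h by rewrite lerDl ltW.
  have [|c cth e] := @MVT_segment R Phi _ t (t + h) th (fun c _ => dPhi c).
    exact: continuous_subspaceT.
  by exists c => //; rewrite /Psi e [t + h]addrC addrK.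
have [c cth e] := mvt 0.
exists c.
  by move: cth; rewrite in_itv /= add0r => /andP[c0 ch]; rewrite ger0_norm.
rewrite mulrC -e /smear /beam /=.
refine (@Rintegral_halfline _ Psi _ (T - h) _ _ _ _ _).
- by rewrite subr_lt0 (lt_trans T0).
- move=> t; apply: (@continuousB _ _ _ (fun t : R => F (x + t *: v + h *: v))
    (fun t : R => F (x + t *: v)) t); last exact: cphi.
  exact: (comp_line_continuous x v (continuous_translate (h *: v) cF)).
- move=> t; rewrite /Psi.
  have d : is_derive t (1 : R) (fun t => Phi (t + h)) (F (x + t *: v + h *: v)).
    by apply: is_derive_translate; rewrite -addrA -scalerDl.
  exact: is_deriveB.
- move=> t tT; have thT : t + h <= T by rewrite -lerBrDr.
  by rewrite -addrA -scalerDl (HT _ thT) HT ?subrr // (le_trans tT) // gerBl ltW.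
- have [c' c'in ->] := mvt (T - h).
  by move: c'in; rewrite in_itv /= subrK => /andP[_ /HT ->]; rewrite mul0r.
Qed.

Lemma continuous_fdiff h s F : continuous F -> continuous (fdiff h s F).
Proof.
move=> cF; elim: s => //= v s IH x.
apply: (@continuousB _ _ _ (fun x => fdiff h s F (x + h *: v)) (fdiff h s F) x).
  exact: (continuous_translate (h *: v) IH).
exact: IH.
Qed.

Arguments continuous_fdiff h s [F] cF : rename.

Lemma vanish_translate M F y : vanish M F -> vanish (M + `|y|) (fun x => F (x + y)).
Proof.
move=> vF x; rewrite -ltrBrDr => Mx; apply: vF; apply: (lt_le_trans Mx).
exact: lerB_normD.
Qed.

Arguments vanish_translate [M F] y vF x : rename.

Lemma vanishW M N F : M <= N -> vanish M F -> vanish N F.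
Proof. by move=> MN vF x Nx; apply: vF; exact: le_lt_trans Nx. Qed.

Lemma vanish_diff M F y : vanish M F -> vanish (M + `|y|) (fun x => F (x + y) - F x).
Proof.
move=> vF x Mx; rewrite (vanish_translate y vF x Mx).
by rewrite (vanishW _ vF Mx) ?subrr // lerDl.
Qed.

Lemma vanish_fdiff h s M F : vanish M F -> exists N, vanish N (fdiff h s F).
Proof.
move=> vF; elim: s => [|v s [N HN]]; first by exists M.
by exists (N + `|h *: v|); exact: vanish_diff.
Qed.

Lemma beam_sub M N F G v x : v != 0 -> continuous F -> continuous G ->
  vanish M F -> vanish N G ->
  beam v (fun x => F x - G x) x = beam v F x - beam v G x.
Proof.
move=> v0 cF cG vF vG; rewrite /beam RintegralB //.
  exact: beam_integrable vF.
exact: beam_integrable vG.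
Qed.

Lemma smear_sub M N F G h v x : v != 0 -> continuous F -> continuous G ->
  vanish M F -> vanish N G ->
  smear h v (fun x => F x - G x) x = smear h v F x - smear h v G x.
Proof.
move=> v0 cF cG vF vG.
have [M' vF'] := vanish_fdiff h [:: v] vF.
have [N' vG'] := vanish_fdiff h [:: v] vG.
rewrite /smear -(beam_sub _ v0 _ _ vF' vG'); try exact: continuous_fdiff.
by congr (beam v _ x); apply/funext => y /=; ring.
Qed.

Lemma smear_translate h v F y : smear h v (fun x => F (x + y)) = fun x => smear h v F (x + y).
Proof.
rewrite /smear -beam_translate; congr beam; apply/funext => x /=.
by rewrite addrAC.
Qed.

Lemma vanish_smear M F h v : 0 < h -> v != 0 -> continuous F -> vanish M F ->
  vanish (M + h * `|v|) (smear h v F).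
Proof.
move=> h0 v0 cF vF x Mx.
have [t th ->] := smear_mean x h0 v0 cF vF.
rewrite (vanish_translate (t *: v) vF) ?mulr0 // (le_lt_trans _ Mx) // lerD2l normrZ.
by rewrite ler_wpM2r.
Qed.

(** By linearity and translation invariance, the difference of two values is a value of the smear of
    F(z + (x - y)) - F(z). By [smear_mean] this is h times one increment of F, small by uniform
    continuity. *)
Lemma continuous_smear M F h v : 0 < h -> v != 0 -> continuous F -> vanish M F ->
  continuous (smear h v F).
Proof.
move=> h0 v0 cF vF x; apply/(@cvgrPdist_lt _ _ _ (nbhs x) (nbhs_filter x)) => e e0.
have [d d0 Hd] := vanish_unif_continuous cF vF (divr_gt0 e0 h0).
apply/nbhs_ballP; exists d => // y; rewrite -ball_normE /ball_ /= => xy.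
have -> : smear h v F x - smear h v F y =
    smear h v (fun z => F (z + (x - y)) - F z) y.
  rewrite (smear_sub _ _ v0 _ cF (vanish_translate (x - y) vF) vF); last first.
    exact: continuous_translate.
  by rewrite smear_translate [y + _]addrC subrK.
have cG : continuous (fun z : 'rV[R]_n => F (z + (x - y)) - F z).
  move=> z; apply: (@continuousB _ _ _ (fun z : 'rV[R]_n => F (z + (x - y))) F z); last exact: cF.
  exact: (continuous_translate (x - y) cF).
have [t th ->] := smear_mean y h0 v0 cG (vanish_diff vF).
rewrite normrM gtr0_norm // mulrC -ltr_pdivlMr //; apply: Hd.
by rewrite addrAC subrr add0r.
Qed.

Arguments continuous_smear [M F h v] h0 v0 cF vF : rename.

Lemma smear_fdiffC M F h v s : 0 < h -> v != 0 -> continuous F -> vanish M F ->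
  smear h v (fdiff h s F) = fdiff h s (smear h v F).
Proof.
move=> h0 v0 cF vF; elim: s => //= w s <-.
have cs := continuous_fdiff h s cF; have [N vs] := vanish_fdiff h s vF.
apply/funext => x.
rewrite (smear_sub _ _ v0 _ cs (vanish_translate (h *: w) vs) vs); last first.
  exact: continuous_translate.
by rewrite smear_translate.
Qed.

Lemma iter_beam_cat s r f : iter_beam (s ++ r) f = iter_beam s (iter_beam r f).
Proof. by elim: s => //= v s ->. Qed.

(** The last letter of s is the first beam applied. Paired with its own difference it turns F into
    [smear h v F], to which the induction hypothesis applies; hence F is only assumed continuous
    with bounded support. *)
Lemma iter_beam_fdiff_mean s M F h x : 0 < h -> all (fun v => v != 0) s ->
  continuous F -> vanish M F ->
  exists2 y, `|y - x| <= h * \sum_(v <- s) `|v| &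
    iter_beam s (fdiff h s F) x = h ^+ size s * F y.
Proof.
move=> h0; elim/last_ind: s M F => [|s v IH] M F.
  by exists x; rewrite ?subrr ?normr0 ?big_nil ?mulr0 // expr0 mul1r.
rewrite all_rcons => /andP[v0 s0] cF vF.
have [y yx e] := IH _ _ s0 (continuous_smear h0 v0 cF vF) (vanish_smear h0 v0 cF vF).
have [t th e'] := smear_mean y h0 v0 cF vF.
exists (y + t *: v).
  rewrite addrAC big_rcons /= mulrDr; apply: (le_trans (ler_normD _ _)).
  by rewrite lerD // normrZ ler_wpM2r.
rewrite size_rcons exprSr -mulrA -e' -e -cats1 iter_beam_cat; congr (iter_beam s _ x).
rewrite -(smear_fdiffC s h0 v0 cF vF) /smear -fdiff_cat /=.
by congr beam; rewrite (fdiff_perm _ _ (t := v :: s)) // perm_catC.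
Qed.

(** The letters of s are absorbed by the beams and those of r become derivatives; the displacements
    of the two mean value points add up to O(h). *)
Lemma iter_beam_fdiff_limit s r f M x : all (fun v => v != 0) s ->
  Cinfty f -> vanish M f ->
  (h ^- size (s ++ r) * iter_beam s (fdiff h (s ++ r) f) x) @[h --> 0^'+] --> dird r f x.
Proof.
move=> s0 Hf vf.
apply: (@mean_value_limit _ _ _ _ _ (\sum_(v <- s ++ r) `|v|)).
  exact: (Cinfty_continuous (Cinfty_dird r Hf)).
move=> h h0; have [N vN] := vanish_fdiff h r vf.
have ct := continuous_fdiff h r (Cinfty_continuous Hf).
have [y yx e] := iter_beam_fdiff_mean x h0 s0 ct vN.
have [z zy e'] := fdiff_mean h r y Hf.
exists z; last by rewrite fdiff_cat e e' size_cat exprD mulrA.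
rewrite -[z](subrK y) -addrA (le_trans (ler_normD _ _)) // big_cat mulrDr [leRHS]addrC.
by rewrite lerD // -[h in leRHS]gtr0_norm.
Qed.

Lemma iter_beam_dird s r g M : all (fun v => v != 0) s -> Cinfty g -> vanish M g ->
  iter_beam s (dird (s ++ r) g) = dird r g.
Proof.
move=> s0 Hg vg; rewrite dird_cat.
have {Hg} Ht := Cinfty_dird r Hg.
have {vg} : vanish M (dird r g) by elim: r {Ht} => //= v r; exact: vanish_derive.
move: (dird r g) Ht => G HG vG.
elim/last_ind: s s0 => [//|s v IH]; rewrite all_rcons => /andP[v0 s0].
rewrite -cats1 iter_beam_cat.
have vs : vanish M (dird s G) by elim: s {IH s0} => //= w s; exact: vanish_derive.
(* Schwarz's theorem brings D_v outermost, next to the beam along v that cancels it. *)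
rewrite (dird_perm (t := v :: s)) //; last by rewrite perm_catC.
by rewrite /= (beam_derive v0 (Cinfty_dird s HG) vs) IH.
Qed.

Lemma iter_beam_translate s f y :
  iter_beam s (fun x => f (x + y)) = fun x => iter_beam s f (x + y).
Proof. by elim: s => //= v s ->; exact: beam_translate. Qed.

(** Convergence is required at every stage, because the intermediate functions need not have bounded
    support. This is the point at which realizability enters. *)
Lemma iter_beam_sub s f g : iter_beam_converges s f -> iter_beam_converges s g ->
  iter_beam s (fun x => f x - g x) = fun x => iter_beam s f x - iter_beam s g x.
Proof.
elim: s => //= v s IH [cf bf] [cg bg]; rewrite (IH cf cg).
by apply/funext => x; rewrite /beam RintegralB //; [exact: bf|exact: bg].
Qed.

End Beam.

Arguments vanish_translate [R n M F] y vF x : rename.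

(** * Star transforms and their dual operators *)

Lemma cvg_sum_seq (R : realType) (T : Type) (I : eqType) (F : set_system T)
    (r : seq I) (f : I -> T -> R) (l : I -> R) : Filter F ->
  (forall i, i \in r -> f i x @[x --> F] --> l i) ->
  \sum_(i <- r) f i x @[x --> F] --> \sum_(i <- r) l i.
Proof.
move=> FF; elim: r => [|i r IH] H.
  by rewrite big_nil; under eq_fun do rewrite big_nil; exact: cvg_cst.
rewrite big_cons; under eq_fun do rewrite big_cons.
apply: cvgD; first by apply: H; rewrite mem_head.
by apply: IH => j jr; apply: H; rewrite in_cons jr orbT.
Qed.

Section StarTransform.
Variables (R : realType) (n : nat).
Implicit Types (S : formal_star R n).

Lemma enorm0 : enorm (0 : 'rV[R]_n) = 0.
Proof.
rewrite /enorm big1 ?sqrtr0 // => i _.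
by rewrite mxE expr0n.
Qed.

Lemma sphere_neq0 (w : sphere R n) : val w != 0.
Proof.
apply: contraL (valP w) => /eqP ->.
by rewrite enorm0 eq_sym oner_eq0.
Qed.

Lemma enorm_neq0 (v : 'rV[R]_n) : v != 0 -> enorm v != 0.
Proof.
move=> v0; apply: contraTneq (enorm_normalize v0) => ->.
by rewrite invr0 scale0r enorm0 eq_sym oner_eq0.
Qed.

Lemma monomial_word_neq0 (k : monalg.cmonom (sphere R n)) :
  all (fun v : 'rV[R]_n => v != 0) (monomial_word k).
Proof.
apply/allP => v /flatten_mapP[w _ /nseqP[-> _]]; exact: sphere_neq0.
Qed.

Lemma mkmalgU_mul (k1 k2 : monalg.cmonom (sphere R n)) (c1 c2 : R) :
  monalg.mkmalgU k1 c1 * monalg.mkmalgU k2 c2 =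
  monalg.mkmalgU (monalg.mmul k1 k2) (c1 * c2) :> formal_star R n.
Proof. by rewrite monalg.malgM_def monalg.fgmulUU. Qed.

Lemma mkmalgU_one : monalg.mkmalgU monalg.mone 1 = 1 :> formal_star R n.
Proof. exact: monalg.mpolyC1E. Qed.

Lemma mkmalgU_exp (k : monalg.cmonom (sphere R n)) (c : R) (a : nat) :
  (monalg.mkmalgU k c : formal_star R n) ^+ a =
  monalg.mkmalgU (iter a (monalg.mmul k) monalg.mone) (c ^+ a) :> formal_star R n.
Proof.
elim: a => [|a IH].
  rewrite (expr0 c) (expr0 (monalg.mkmalgU k c : formal_star R n)).
  exact (esym mkmalgU_one).
rewrite (exprS c) (exprS (monalg.mkmalgU k c : formal_star R n)) IH.
exact: mkmalgU_mul.
Qed.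

Lemma star_op_sub S f g : realizable S -> Ccinfty f -> Ccinfty g ->
  star_op S (fun x => f x - g x) = fun x => star_op S f x - star_op S g x.
Proof.
move=> rS Hf Hg; apply/funext => x; rewrite /star_op -sumrB.
rewrite big_seq [RHS]big_seq; apply: eq_bigr => k kS.
by rewrite (iter_beam_sub (rS f Hf k kS) (rS g Hg k kS)) mulrBr.
Qed.

Lemma star_op_translate S f y :
  star_op S (fun x => f (x + y)) = fun x => star_op S f (x + y).
Proof.
apply/funext => x; rewrite /star_op; apply: eq_bigr => k _.
by rewrite iter_beam_translate.
Qed.

Lemma Ccinfty_translate (f : 'rV[R]_n -> R) y : Ccinfty f -> Ccinfty (fun x => f (x + y)).
Proof.
move=> Hf; have [M _ vf] := Ccinfty_vanish Hf.
refine (@vanish_Ccinfty _ _ (M + `|y|) _ _ (vanish_translate y vf)).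
by apply: Cinfty_translate; case: Hf.
Qed.

Lemma Ccinfty_sub (f g : 'rV[R]_n -> R) :
  Ccinfty f -> Ccinfty g -> Ccinfty (fun x => f x - g x).
Proof.
move=> Hf Hg; have [M _ vf] := Ccinfty_vanish Hf; have [N _ vg] := Ccinfty_vanish Hg.
apply: (@vanish_Ccinfty _ _ (Num.max M N)).
  by apply: Cinfty_sub; [case: Hf|case: Hg].
by move=> x; rewrite gt_max => /andP[/vf -> /vg ->]; rewrite subrr.
Qed.

Lemma Ccinfty_fdiff h s (f : 'rV[R]_n -> R) : Ccinfty f -> Ccinfty (fdiff h s f).
Proof.
by move=> Hf; elim: s => //= v s IH; apply: Ccinfty_sub => //; exact: Ccinfty_translate.
Qed.

Lemma star_op_fdiff S h s f : realizable S -> Ccinfty f ->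
  star_op S (fdiff h s f) = fdiff h s (star_op S f).
Proof.
move=> rS Hf; elim: s => //= v s IH; have Hs := Ccinfty_fdiff h s Hf.
by rewrite (star_op_sub rS (Ccinfty_translate (h *: v) Hs) Hs) star_op_translate IH.
Qed.

End StarTransform.

(** * Passage from the star transform to its dual operator *)

Section DualOperator.
Variables (R : realType) (n m : nat) (u : 'I_m -> 'rV[R]_n).
Hypothesis u_neq0 : forall i, u i != 0.
Variable p : mpoly.mpoly m R.

Local Notation S := (star_transform u_neq0 p).
Local Notation dir i := (direction (u_neq0 i)).

(** The monomial in unit directions to which x^k is sent, up to a scalar. Branch vectors that are
    positive multiples of one another share a symbol, so their exponents add up. *)
Definition star_monomial (k : mpoly.multinom m) : monalg.cmonom (sphere R n) :=
  \big[monalg.mmul/monalg.mone]_(i < m)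
    iter (k i) (monalg.mmul (monalg.ucm (dir i))) monalg.mone.

Lemma star_monomialE k w : star_monomial k w = (\sum_i (dir i == w) * k i)%N.
Proof.
rewrite /star_monomial; elim: (index_enum _) => [|i s IH].
  by rewrite !big_nil monalg.cm1.
rewrite !big_cons monalg.cmM IH; congr addn.
elim: (k i) => [|a IHa]; first by rewrite muln0 monalg.cm1.
by rewrite /= monalg.cmM IHa monalg.cmU mulnS.
Qed.

Lemma star_transformE : S = \sum_(k <- mpoly.msupp p)
  monalg.mkmalgU (star_monomial k)
    (mpoly.mcoeff k p * \prod_i (enorm (u i))^-1 ^+ k i) :> formal_star R n.
Proof.
rewrite /star_transform /mpoly.mmap; apply: eq_bigr => k _.
have -> : mpoly.mmap1 (fun i => beam_symbol (u_neq0 i)) k =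
    monalg.mkmalgU (star_monomial k) (\prod_i (enorm (u i))^-1 ^+ k i) :> formal_star R n.
  rewrite /mpoly.mmap1 /star_monomial; elim: (index_enum _) => [|i s IH].
    rewrite !big_nil; exact (esym (mkmalgU_one R n)).
  rewrite !big_cons IH mkmalgU_exp; exact: mkmalgU_mul.
rewrite (mkmalgU_mul monalg.mone) monalg.mul1m; reflexivity.
Qed.

(* Parallel branch vectors may make monomials of [p] merge or cancel in the formal
   algebra, hence this passage from the support of [S] to that of [p]. *)
Lemma star_transform_lin (phi : monalg.cmonom (sphere R n) -> R) :
  \sum_(k <- monalg.msupp S) monalg.mcoeff k S * phi k =
  \sum_(k <- mpoly.msupp p)
    mpoly.mcoeff k p * (\prod_i (enorm (u i))^-1 ^+ k i) * phi (star_monomial k).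
Proof.
(* Read as [mmap], the sum is additive in the algebra element, so merging and cancellation cause no
   harm. *)
transitivity (monalg.mmap (@idfun R) phi S); first by [].
rewrite star_transformE raddf_sum /=; apply: eq_bigr => k _.
by rewrite monalg.mmapU.
Qed.

Lemma star_op_monomialE f x : star_op S f x =
  \sum_(k <- mpoly.msupp p)
    mpoly.mcoeff k p * (\prod_i (enorm (u i))^-1 ^+ k i) *
    iter_beam (monomial_word (star_monomial k)) f x.
Proof. exact: (star_transform_lin (fun k => iter_beam (monomial_word k) f x)). Qed.

Lemma perm_monomial_word k :
  perm_eq (monomial_word (star_monomial k)) (word (fun i => val (dir i)) k).
Proof.
apply/permP => a; rewrite count_word /monomial_word count_flatten -map_comp sumnE big_map.
under eq_bigr do rewrite /= count_nseq star_monomialE big_distrr /=.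
rewrite exchange_big /=; apply: eq_bigr => i _.
have [k0|k0] := posnP (k i).
  by rewrite k0 muln0 big1 // => w _; rewrite muln0 muln0.
rewrite (bigD1_seq (dir i)) ?finmap.fset_uniq //=; last first.
  by rewrite -monalg.cmE_neq0 star_monomialE (bigD1 i) //= eqxx mul1n -lt0n addn_gt0 k0.
rewrite eqxx mul1n big1 ?addn0 // => w wi.
by rewrite eq_sym (negbTE wi) mul0n muln0.
Qed.

Lemma leq_degree_in k j : k \in mpoly.msupp p -> (k j <= degree_in j p)%N.
Proof. by move=> kp; exact: (@leq_bigmax_seq _ _ _ (fun k : mpoly.multinom m => k j)). Qed.

(** The word of D^d, in unit directions like the formal algebra: every monomial word of p is a part
    of it, and the complement carries the reciprocal exponent d - k. *)
Definition full_word := word (fun i => val (dir i)) (fun j => degree_in j p).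

Lemma perm_full_word k : k \in mpoly.msupp p ->
  perm_eq full_word (monomial_word (star_monomial k) ++
    word (fun i => val (dir i)) (fun j => degree_in j p - k j)%N).
Proof.
move=> kp; rewrite perm_sym.
rewrite (perm_trans (perm_cat (perm_monomial_word k) (perm_refl _))) //.
rewrite perm_sym (perm_trans _ (perm_wordD _ _ _)) //.
rewrite /full_word (@eq_word _ _ _ (fun j => degree_in j p)
  (fun j => k j + (degree_in j p - k j))%N) //.
by move=> j; rewrite subnKC // leq_degree_in.
Qed.

Lemma dual_opE f : Cinfty f -> dual_op u p f = fun x =>
  \sum_(k <- mpoly.msupp p)
    mpoly.mcoeff k p * dird (word u (fun j => degree_in j p - k j)%N) f x.
Proof.
move=> Hf; apply/funext => x; rewrite /dual_op /poly_deriv -/(mlin _ _) mlin_sum.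
apply: eq_bigr => k _; rewrite mlinZ mlinX iter_derivE.
congr (_ * dird _ _ _); apply: eq_word => j; exact: mpoly.mnmE.
Qed.

Lemma dird_wordZ (a : 'I_m -> R) (k : 'I_m -> nat) f : Cinfty f ->
  dird (word (fun i => a i *: u i) k) f =
  fun x => (\prod_i a i ^+ k i) * dird (word u k) f x.
Proof.
move=> Hf.
(* Both words are images of the same word of indices, on which the induction can run. *)
have wordE (T : Type) (v : 'I_m -> T) : word v k = map v (word id k).
  by rewrite /word map_flatten -map_comp; congr flatten; apply: eq_map => i /=; rewrite map_nseq.
have prodE : \prod_i a i ^+ k i = \prod_(i <- word id k) a i.
  rewrite big_flatten big_map -[in LHS]big_enum /=.
  by apply: eq_bigr => i _; rewrite big_nseq iter_mulr_1.
rewrite prodE [word u k]wordE wordE; elim: (word id k) => [|i s IH] /=.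
  by apply/funext => x; rewrite big_nil mul1r.
have Hs := Cinfty_dird (map u s) Hf.
rewrite IH big_cons; apply/funext => x.
rewrite derive_scaleE // !(Cinfty_deriveE Hs) [LHS]mulr_sumr [RHS]mulr_sumr.
by apply: eq_bigr => j _; rewrite mxE; ring.
Qed.

Lemma all_full_word : all (fun v : 'rV[R]_n => v != 0) full_word.
Proof.
apply/allP => v /flatten_mapP[i _ /nseqP[-> _]]; exact: sphere_neq0.
Qed.

(** The coefficient contributes |u_i|^(-k_i), and normalizing the remaining d_i - k_i derivatives
    contributes |u_i|^(k_i - d_i). The product does not depend on k and factors out of the sum. *)
Lemma weighted_rest k f : k \in mpoly.msupp p -> Cinfty f ->
  (fun x => (\prod_i (enorm (u i))^-1 ^+ k i) *
    dird (word (fun i => val (dir i)) (fun j => degree_in j p - k j)%N) f x) =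
  fun x => (\prod_i (enorm (u i))^-1 ^+ degree_in i p) *
    dird (word u (fun j => degree_in j p - k j)%N) f x.
Proof.
move=> kp Hf; apply/funext => x.
rewrite (dird_wordZ (fun i => (enorm (u i))^-1) _ Hf) mulrA -big_split /=.
congr (_ * _); apply: eq_bigr => i _.
by rewrite -exprD subnKC // leq_degree_in.
Qed.

Local Notation weight := (\prod_i (enorm (u i))^-1 ^+ degree_in i p).

Lemma weight_neq0 : weight != 0.
Proof.
by apply/prodf_neq0 => i _; rewrite expf_neq0 // invr_eq0 enorm_neq0.
Qed.

Lemma dual_op_sumE f x : Cinfty f -> \sum_(k <- mpoly.msupp p)
    mpoly.mcoeff k p * (\prod_i (enorm (u i))^-1 ^+ k i) *
    dird (word (fun i => val (dir i)) (fun j => degree_in j p - k j)%N) f x =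
  weight * dual_op u p f x.
Proof.
move=> Hf; rewrite dual_opE // mulr_sumr big_seq [RHS]big_seq; apply: eq_bigr => k kp.
have /(congr1 (@^~ x)) /= e := weighted_rest kp Hf.
by rewrite -mulrA e mulrCA.
Qed.

Lemma star_op_dird M f x : Cinfty f -> vanish M f ->
  star_op S (dird full_word f) x = weight * dual_op u p f x.
Proof.
move=> Hf vf; rewrite star_op_monomialE -dual_op_sumE // big_seq [RHS]big_seq.
apply: eq_bigr => k kp; congr (_ * _).
rewrite (dird_perm Hf (perm_full_word kp)).
by rewrite (iter_beam_dird _ (monomial_word_neq0 _) Hf vf).
Qed.

(** One power of h serves all monomials, since each monomial word together with its complement has
    the length of [full_word]. *)
Lemma star_op_fdiff_limit M f x : Cinfty f -> vanish M f ->
  (h ^- size full_word * star_op S (fdiff h full_word f) x) @[h --> 0^'+] -->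
  weight * dual_op u p f x.
Proof.
move=> Hf vf; rewrite -dual_op_sumE //.
under eq_fun do rewrite star_op_monomialE mulr_sumr.
apply: cvg_sum_seq => k kp.
under eq_fun do rewrite mulrCA.
apply: cvgM; first exact: cvg_cst.
rewrite (perm_size (perm_full_word kp)).
under eq_fun do rewrite (fdiff_perm _ _ (perm_full_word kp)).
exact: (@iter_beam_fdiff_limit _ _ _ _ f M x (monomial_word_neq0 _) Hf vf).
Qed.

End DualOperator.

Theorem theorem2p3 (R : realType) (n m : nat) (u : 'I_m -> 'rV[R]_n)
    (u_neq0 : forall i, u i != 0) (p : mpoly.mpoly m R) :
  star_transform u_neq0 p != 0 ->
  realizable (star_transform u_neq0 p) ->
  (set_inj (@Ccinfty R n) (star_op (star_transform u_neq0 p)) <->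
   ~ (forall f : 'rV[R]_n -> R, Cinfty f -> dual_op u p f = cst 0)).
Proof.
move=> _ rS; split => [inj L0|L0 f1 f2 /set_mem Hf1 /set_mem Hf2 eSf].
- have [g [Hg vg g0]] := bump_exists R n.
  have Hz : Cinfty (fun _ : 'rV[R]_n => 0 : R) by exact: Cinfty_cst.
  have vz : vanish 1 (fun _ : 'rV[R]_n => 0 : R) by [].
  have CcD f : Cinfty f -> vanish 1 f -> Ccinfty (dird (full_word u_neq0 p) f).
    move=> Hf vf; apply: (@vanish_Ccinfty _ _ 1); first exact: Cinfty_dird.
    by elim: (full_word u_neq0 p) => //= v s; exact: vanish_derive.
  have e : dird (full_word u_neq0 p) g = dird (full_word u_neq0 p) (fun=> 0).
    apply: inj; [exact/mem_set/CcD|exact/mem_set/CcD|apply/funext => x].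
    by rewrite (@star_op_dird _ _ _ _ u_neq0 p _ g x Hg vg)
      (@star_op_dird _ _ _ _ u_neq0 p _ _ x Hz vz) !L0.
  (* D^d g is not 0: the beams along all of [full_word] recover g from it. *)
  have := iter_beam_dird [::] (all_full_word u_neq0 p) Hg vg.
  have := iter_beam_dird [::] (all_full_word u_neq0 p) Hz vz.
  rewrite cats0 e => -> /(congr1 (@^~ 0)) /= g00.
  by rewrite -g00 eqxx in g0.
- pose f x := f1 x - f2 x.
  have Cf : Ccinfty f by exact: Ccinfty_sub.
  have [Hf _] := Cf; have [M M0 vf] := Ccinfty_vanish Cf.
  have Sf : star_op (star_transform u_neq0 p) f = fun=> 0.
    by rewrite star_op_sub // eSf; apply/funext => x; rewrite subrr.
  have fdiff0 h s : fdiff h s (fun _ : 'rV[R]_n => 0 : R) = fun=> 0.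
    by elim: s => //= v s ->; apply/funext => x; rewrite subrr.
  have Lf x : dual_op u p f x = 0.
    have := @star_op_fdiff_limit _ _ _ _ u_neq0 p _ f x Hf vf.
    (* The scaled quantity is 0 for every h, so its limit, a nonzero weight times L f, is 0. *)
    under eq_fun do rewrite star_op_fdiff // Sf fdiff0 mulr0.
    move=> H; apply: (mulfI (weight_neq0 u_neq0 p)); rewrite mulr0.
    by apply: cvg_unique H _ => //; exact: cvg_cst.
  have [P HP] := poly_deriv_symbol u (reciprocal p).
  have f0 : f = fun=> 0.
    (* The half-width M + 1 of the grid box leaves a margin around the support of f. *)
    apply: (@pdo_inj _ _ M (M + 1) M0 _ P) => //.
    + by rewrite ltrDl.
    + apply/eqP => P0; apply: L0 => g Hg.
      by rewrite /dual_op HP // P0 poly_deriv0.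
    + by rewrite -HP //; apply/funext => x; exact: Lf.
  apply/funext => x; apply/eqP; rewrite -subr_eq0.
  by rewrite -/(f x) f0.
Qed.
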